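(* Let $I=(h_1,\ldots,h_m)\subseteq\mathbb{R}[\mathbf{x}]$, $D=\max_j\deg(h_j)$, let $L^*$ be a generic element of $\mathcal{K}_{t,\succeq}$ and let $1\le s\le\lfloor t/2\rfloor$. Let $\mathcal{G}_t=\mathcal{H}_t\cup\mathcal{W}_t$ and consider the conditions $$\text{(R)}\quad \mathrm{rank}\,M_s(L^* )=\mathrm{rank}\,M_{s-1}(L^* ),$$ $$\text{(A)}\quad \dim\pi_{2s}(\mathcal{G}_t^\perp)=\dim\pi_{s-1}(\mathcal{G}_t^\perp),\qquad \text{(B)}\quad \dim\pi_{2s}(\mathcal{G}_t^\perp)=\dim\pi_{2s}((\mathcal{G}_t^+)^\perp).$$ (i) Assume (R) holds. Then (A) holds, and (B) holds as well if $s\ge D$. (ii) Assume (A) and (B) hold. Then (R) holds. Moreover, the ideal $J$ associated with the pair $(t,2s)$ and $\mathcal{G}_t$ (constructed as described in the context; it is obtained from a set $\mathcal{B}_0$ as described there, such sets exist, and the assertions hold for any choice of $\mathcal{B}_0$) is real radical and satisfies $J=(\mathrm{Ker}\,M_s(L^* ))\subseteq I(V_{\mathbb{R}}(I))$; and, given $\mathcal{B}\subseteq\mathbb{T}^n_{s-1}$, $\mathcal{B}$ satisfies $$\mathbb{R}[\mathbf{x}]_{s-1}=\mathrm{Span}_{\mathbb{R}}(\mathcal{B})\oplus\big(\mathrm{Span}_{\mathbb{R}}(\mathcal{G}_t)\cap\mathbb{R}[\mathbf{x}]_{s-1}\big)$$ if and only if $\mathcal{B}$ indexes a column basis of $M_{s-1}(L^*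 )$. Furthermore, $J=\sqrt[\mathbb{R}]{I}$ if $s\ge D$.
   Context: $\mathbb{R}[\mathbf{x}]=\mathbb{R}[x_1,\ldots,x_n]$, $\mathbb{R}[\mathbf{x}]_t$ is the subspace of polynomials of degree at most $t$, $\mathbb{N}^n_t=\{\alpha\in\mathbb{N}^n\mid|\alpha|\le t\}$, and $\mathbb{T}^n_t$ is the set of monomials of degree at most $t$. $V_{\mathbb{R}}(I)$ is the set of common real zeros of $I$, $I(V)$ is the ideal of polynomials in $\mathbb{R}[\mathbf{x}]$ vanishing on $V$, and $\sqrt[\mathbb{R}]{I}=\{p\mid p^{2k}+\sum_jq_j^2\in I\text{ for some }q_j\in\mathbb{R}[\mathbf{x}],\ k\ge1\}$ (finite sum) is the real radical, which equals $I(V_{\mathbb{R}}(I))$; an ideal $J$ is real radical if $J=\sqrt[\mathbb{R}]{J}$. Duality. For $B\subseteq A$, $B^\perp=\{L\in A^*\mid L(b)=0\ \forall b\in B\}$. For $S\subseteq\mathbb{R}[\mathbf{x}]$, $S^+:=S\cup x_1S\cup\cdots\cup x_nS$. $\mathcal{G}_t^\perp$ is taken in $(\mathbb{R}[\mathbf{x}]_t)^*$, $(\mathcal{G}_t^+)^\perp$ in $(\mathbb{R}[\mathbf{x}]_{t+1})^*$. $\pi_s$ denotes restriction of linear functionals to $\mathbb{R}[\mathbf{x}]_s$. Moment matrices. For $L\in(\mathbb{R}[\mathbf{x}]_t)^*$ and $2s\le t$, $M_s(L)$ is the matrix indexed by $\mathbb{N}^n_s$ (equivalently $\mathbb{T}^n_s$)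 with $(\alpha,\beta)$-entry $L(\mathbf{x}^{\alpha+\beta})$; $\mathrm{Ker}\,M_s(L)$ is viewed as a subset of $\mathbb{R}[\mathbf{x}]_s$ by identifying a polynomial with its coefficient vector. $\mathcal{H}_t:=\{\mathbf{x}^\alpha h_j\mid|\alpha|+\deg(h_j)\le t,\ j=1,\ldots,m\}$. $\mathcal{K}_{t,\succeq}:=\{L\in\mathcal{H}_t^\perp\mid M_{\lfloor t/2\rfloor}(L)\succeq0\}$, where $\mathcal{H}_t^\perp\subseteq(\mathbb{R}[\mathbf{x}]_t)^*$. $L^*\in\mathcal{K}_{t,\succeq}$ is generic if $\mathrm{rank}\,M_{\lfloor t/2\rfloor}(L^* )=\max_{L\in\mathcal{K}_{t,\succeq}}\mathrm{rank}\,M_{\lfloor t/2\rfloor}(L)$. All generic elements have the same kernel $\mathcal{N}_t:=\mathrm{Ker}\,M_{\lfloor t/2\rfloor}(L^* )$, and $\mathcal{W}_t:=\{\mathbf{x}^\alpha g\mid\alpha\in\mathbb{N}^n_{\lfloor t/2\rfloor},\ g\in\mathcal{N}_t\}$. The ideal $J$. For $\mathcal{B}_0\subseteq\mathbb{T}^n$, $\partial\mathcal{B}_0:=\mathcal{B}_0^+\setminus\mathcal{B}_0$; $\mathcal{B}_0$ is connected to 1 if each $m\in\mathcal{B}_0$ can be written as $m=m_1m_2\cdots m_k$ with $m_1=1$, $m_2,\ldots,m_k\in\{x_1,\ldots,x_n\}$ and $m_1\cdots m_h\in\mathcal{B}_0$ for all $h\le k$. Choose a set $\mathcal{B}_0\subseteq\mathbb{T}^n_{2s-1}$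 connected to 1 with $\mathbb{R}[\mathbf{x}]_{2s}=\mathrm{Span}_{\mathbb{R}}(\mathcal{B}_0)\oplus(\mathbb{R}[\mathbf{x}]_{2s}\cap\mathrm{Span}_{\mathbb{R}}(\mathcal{G}_t))$, let $\varphi$ be the projection from $\mathbb{R}[\mathbf{x}]_{2s}$ onto $\mathrm{Span}_{\mathbb{R}}(\mathcal{B}_0)$ along $\mathbb{R}[\mathbf{x}]_{2s}\cap\mathrm{Span}_{\mathbb{R}}(\mathcal{G}_t)$, and let $J$ be the ideal generated by $\{m-\varphi(m)\mid m\in\partial\mathcal{B}_0\}$; in the degenerate case $\dim\pi_{2s}(\mathcal{G}_t^\perp)=0$ (so $\mathcal{B}_0=\emptyset$) set $J:=\mathbb{R}[\mathbf{x}]$. *)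

(* Defs.v *)
From HB Require Import structures.
From mathcomp Require Import all_boot all_order all_algebra.
From mathcomp Require Import boolp classical_sets reals.
From mathcomp Require Import mpoly.
Set Implicit Arguments.
Unset Strict Implicit.
Unset Printing Implicit Defensive.
Import Order.TTheory GRing.Theory Num.Theory.
Local Open Scope classical_set_scope.
Local Open Scope ring_scope.

Section TruncatedPolynomials.
Variables (n : nat) (R : fieldType) (t : nat).

(* msize p is deg p + 1, and msize 0 = 0. *)
Definition deg_le : pred {mpoly R[n]} := fun p => (msize p <= t.+1)%N.

(* R[x]_t as a finite-dimensional vector space. *)
Record mpoly_le := MPolyLe {
  mpoly_of_le :> {mpoly R[n]};
  _ : mpoly_of_le \in deg_le }.

Lemma deg_le_submod_closed : submod_closed deg_le.
Proof.
split=> [|c p q]; rewrite !unfold_in ?msize0 // => hp hq.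
apply: leq_trans (msizeD_le _ _) _; rewrite geq_max hq andbT.
exact: leq_trans (msizeZ_le _ _) hp.
Qed.

HB.instance Definition _ :=
  GRing.isSubmodClosed.Build R {mpoly R[n]} deg_le deg_le_submod_closed.

HB.instance Definition _ := [isSub for @mpoly_of_le].
HB.instance Definition _ := [Choice of mpoly_le by <:].
HB.instance Definition _ := [SubChoice_isSubLmodule of mpoly_le by <:].

Lemma mpoly_le_vecaxiom : Vector.axiom #|{: 'X_{1..n < t.+1}}| mpoly_le.
Proof.
pose N := #|{: 'X_{1..n < t.+1}}|.
pose e (i : 'I_N) : 'X_{1..n} := bmnm (enum_val i).
have e_inj : injective e by move=> i j /val_inj/enum_val_inj.
pose f (p : mpoly_le) : 'rV[R]_N := \row_i (val p)@_(e i).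
have f_lin : linear f.
  by move=> c p q; apply/rowP=> i; rewrite !mxE linearP.
exists f => //.
have Pg (v : 'rV[R]_N) : \sum_i v 0 i *: 'X_[e i] \in deg_le.
  rewrite rpred_sum // => i _; rewrite rpredZ // unfold_in msizeX.
  exact: bmdeg.
pose g v := MPolyLe (Pg v).
have fg : cancel g f.
  move=> v; apply/rowP=> i; rewrite mxE /= raddf_sum /= (bigD1 i) //=.
  rewrite mcoeffZ mcoeffX eqxx mulr1 big1 ?addr0 // => j ne_ji.
  by rewrite mcoeffZ mcoeffX (inj_eq e_inj) (negbTE ne_ji) mulr0.
exists g => // p; apply: val_inj; apply/mpolyP => m.
case: (ltnP (mdeg m) t.+1) => hm.
  have /rowP /(_ (enum_rank (BMultinom hm))) := fg (f p).
  by rewrite !mxE /e enum_rankK.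
have z (q : mpoly_le) : (val q)@_m = 0.
  by apply/memN_msupp_eq0/msize_mdeg_ge; apply: leq_trans hm; apply: (valP q).
by rewrite !z.
Qed.

HB.instance Definition _ :=
  Lmodule_hasFinDim.Build R mpoly_le mpoly_le_vecaxiom.

End TruncatedPolynomials.

(* The dual space of R[x]_t. *)
Notation dual_le n R t := 'Hom(mpoly_le n R t, R%type^o).

Section VectorSpaceSets.
Variable K : fieldType.

(* The dimension of a set that is a linear subspace (0 on any other set). *)
Definition set_dim (V : vectType K) (S : set V) : nat :=
  \dim (xget 0%VS [set U : {vspace V} | [set` U] = S]).

Lemma subspace_vspace (V : vectType K) (S : set V) :
  S 0 -> (forall a u v, S u -> S v -> S (a *: u + v)) ->
  exists U : {vspace V}, [set` U] = S.
Proof.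
move=> S0 SD.
pose P (d : nat) := `[< exists U : {vspace V}, [set` U] `<=` S /\ \dim U = d >].
have exP : exists d, P d.
  exists 0%N; apply/asboolP; exists 0%VS; split; last exact: dimv0.
  by move=> x /=; rewrite memv0 => /eqP ->.
have ubP d : P d -> (d <= \dim {: V})%N.
  by move=> /asboolP[U [_ <-]]; apply/dimvS/subvf.
case: (ex_maxnP exP ubP) => d /asboolP[U [US dU]] dmax.
exists U; apply/seteqP; split=> // v Sv /=.
apply: contrapT => /negP vU.
have : P (\dim (U + <[v]>)%VS).
  apply/asboolP; exists (U + <[v]>)%VS; split=> // x /= /memv_addP[u uU].
  by move=> [w /vlineP[a ->] ->]; rewrite addrC; apply: SD => //; apply: US.
move/dmax; rewrite -dU => le_dim.
have /eqP E : (U == U + <[v]>)%VS by rewrite eqEdim addvSl.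
by move: vU; rewrite E => /negP; apply; apply: (subvP (addvSr _ _)); apply: memv_line.
Qed.

Lemma set_dimE (V : vectType K) (U : {vspace V}) : set_dim [set` U] = \dim U.
Proof.
rewrite /set_dim; case: xgetP => [W _ /= WU|/(_ U) []//].
congr (\dim _); apply/vspaceP => x.
by have /= E := congr1 (fun S : set V => S x) WU; apply/idP/idP; rewrite E.
Qed.

Variable M : lmodType K.
Implicit Types S U A B : set M.

Definition lin_span S : set M :=
  [set p | exists k (c : 'I_k -> K) (g : 'I_k -> M),
     (forall i, S (g i)) /\ p = \sum_i c i *: g i].

(* U = A (+) B, for linear subspaces U, A and B. *)
Definition direct_sum U A B : Prop :=
  U = [set a + b | a in A & b in B] /\ A `&` B = [set 0].

(* The projection onto A along B, evaluated at p in A (+) B. *)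
Definition proj_along A B (p : M) : M := xget 0 [set a | A a /\ B (p - a)].

End VectorSpaceSets.

Section Ideals.
Variables (n : nat) (R : realType).
Implicit Types (S I : set {mpoly R[n]}).

Definition ideal_gen S : set {mpoly R[n]} :=
  [set p | exists k (c g : 'I_k -> {mpoly R[n]}),
     (forall i, S (g i)) /\ p = \sum_i c i * g i].

Definition real_variety I : set ('I_n -> R) :=
  [set v | forall p, I p -> p.@[v] = 0].

Definition vanishing_ideal (V : set ('I_n -> R)) : set {mpoly R[n]} :=
  [set p | forall v, V v -> p.@[v] = 0].

Definition real_radical I : set {mpoly R[n]} :=
  [set p | exists k r (q : 'I_r -> {mpoly R[n]}),
     (0 < k)%N /\ I (p ^+ k.*2 + \sum_j q j ^+ 2)].

Definition is_real_radical I : Prop := I = real_radical I.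

End Ideals.

Section Moments.
Variables (n : nat) (R : realType).
Implicit Types (S G B : set {mpoly R[n]}) (s t m : nat).

Definition polys_le t : set {mpoly R[n]} := [set p | (msize p <= t.+1)%N].

Definition monoms_le t : set {mpoly R[n]} :=
  [set 'X_[a] | a in [set a : 'X_{1..n} | (mdeg a <= t)%N]].

(* S^+ *)
Definition plus S : set {mpoly R[n]} :=
  S `|` [set p | exists i q, S q /\ p = 'X_i * q].

Definition perp t S : set (dual_le n R t) :=
  [set L | forall p : mpoly_le n R t, S p -> L p = 0].
Arguments perp t S : clear implicits.

(* L(p) for p in R[x]_t; insubd sends any other polynomial to 0. *)
Definition leval t (L : dual_le n R t) (p : {mpoly R[n]}) : R :=
  L (insubd (0 : mpoly_le n R t) p).

(* The restriction of L to R[x]_s, meaningful when s <= t. *)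
Definition restr s t (L : dual_le n R t) : dual_le n R s :=
  linfun (fun p : mpoly_le n R s => leval L p : R^o).
Arguments restr s {t} L.

(* Monomials of degree <= s, in the order of enum, index rows and columns. *)
Definition bmon s (i : 'I_#|{: 'X_{1..n < s.+1}}|) : 'X_{1..n} :=
  bmnm (enum_val i).

(* M_s(L), meaningful when 2s <= t. *)
Definition moment_mx s t (L : dual_le n R t) :
    'M[R]_#|{: 'X_{1..n < s.+1}}| :=
  \matrix_(i, j) leval L 'X_[(bmon i + bmon j)%MM].

Definition ker_moment s t (L : dual_le n R t) : set {mpoly R[n]} :=
  [set p | polys_le s p /\ moment_mx s L *m (\col_i p@_(bmon i)) = 0].

Definition psd k (A : 'M[R]_k) : Prop :=
  A^T = A /\ forall v : 'cV[R]_k, 0 <= (v^T *m A *m v) 0 0.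

(* The members of B, a set of monomials of degree <= s, index columns of M_s(L)
   that form a basis of its column space. *)
Definition indexes_column_basis s t (L : dual_le n R t) B : Prop :=
  let A := moment_mx s L in
  basis_of <<[seq col i A | i <- enum 'I__]>>%VS
           [seq col i A | i <- enum 'I__ & `[< B 'X_[bmon i] >]].

Section System.
Variables (m : nat) (h : 'I_m -> {mpoly R[n]}).

(* The degree; the zero polynomial gets degree 0. *)
Definition tdeg (p : {mpoly R[n]}) : nat := (msize p).-1.

Definition Hset t : set {mpoly R[n]} :=
  [set p | exists (a : 'X_{1..n}) (j : 'I_m),
     (mdeg a + tdeg (h j) <= t)%N /\ p = 'X_[a] * h j].

Definition Kset t : set (dual_le n R t) :=
  [set L | perp t (Hset t) L /\ psd (moment_mx t./2 L)].
Arguments Kset t : clear implicits.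

Definition generic t (L : dual_le n R t) : Prop :=
  Kset t L /\
  forall L', Kset t L' -> (\rank (moment_mx t./2 L') <= \rank (moment_mx t./2 L))%N.

(* W_t, where L is a generic element. *)
Definition Wset t (L : dual_le n R t) : set {mpoly R[n]} :=
  [set p | exists (a : 'X_{1..n}) g,
     [/\ (mdeg a <= t./2)%N, ker_moment t./2 L g & p = 'X_[a] * g]].

Definition Gset t (L : dual_le n R t) : set {mpoly R[n]} := Hset t `|` Wset L.

End System.

Definition connected_to_1 B : Prop :=
  forall p, B p -> exists2 r : seq 'I_n, p = \prod_(i <- r) 'X_i &
    forall k, (k <= size r)%N -> B (\prod_(i <- take k r) 'X_i).

Definition boundary B : set {mpoly R[n]} := plus B `\` B.

(* R[x]_u `&` Span(G), along which phi projects R[x]_u. *)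
Definition span_le u G : set {mpoly R[n]} := polys_le u `&` lin_span G.

(* The sets B_0 attached to the pair (t, u) and G. *)
Definition admissible_basis u G B : Prop :=
  [/\ B `<=` monoms_le u.-1, connected_to_1 B &
      direct_sum (polys_le u) (lin_span B) (span_le u G)].

(* The dimension of pi_u(G^perp), for G a subset of R[x]_t. *)
Definition dim_restr_perp u t G : nat := set_dim (restr u @` perp t G).

(* The ideal J, generated by the p - phi(p) for p in the boundary of B. When the
   dimension is 0, B is empty and so is its boundary: J is then the unit ideal. *)
Definition border_ideal u t G B : set {mpoly R[n]} :=
  if dim_restr_perp u t G == 0%N then setT
  else ideal_gen
    [set p - proj_along (lin_span B) (span_le u G) p | p in boundary B].

End Moments.

Arguments polys_le {n R} t.
Arguments monoms_le {n R} t.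
Arguments perp {n R} t S.
Arguments Kset {n R m} h t.

(* Main.v *)
(** A flat moment form extends to R[x]: if rank M_s(L) = rank M_(s-1)(L), then
    multiplication by the variables induces commuting operators on
    R[x]_s / Ker M_s(L), and evaluating polynomials at these operators extends L
    from R[x]_2s to a positive functional on R[x] whose null space is the ideal
    (Ker M_s(L)), which is therefore real radical.

    For generic L, every p in N_t lies in the real radical P of I, without the
    real Nullstellensatz: since a sum of squares lies in P only if each square
    root does, some functional on R[x]_t vanishes on P and is positive on p ^ 2
    for all p of degree at most t/2 outside P. It belongs to K_t, so its kernel
    contains N_t.

    Dually, (A) says R[x]_2s = R[x]_(s-1) + (R[x]_2s :&: Span G_t), and (B) says
    that R[x]_2s :&: Span G_t is stable under multiplication by variables as long
    as the degree stays at most 2s. *)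

(* For (B), the extension of L is fed back into K_t. When s >= D every h_j lies in Ker M_s(L), so
   H_t lies in J = (Ker M_s(L)) and the extension, cut off at degree t, belongs to K_t. Genericity
   then bounds N_t by its kernel, which puts G_t, hence G_t^+, inside J; and elements of J of degree
   at most s - 1 are back in Ker M_s(L), hence in Span G_t. The functional for the real radical has
   to be found without knowing that the cone of sums of squares modulo P is closed. Minimising the
   norm over sums of exactly N + 1 squares with normalised roots, N being the dimension of the space
   of roots, is a compact problem; N + 1 roots always satisfy a linear relation, along which a
   further square can be added without first-order effect. In (ii) the two sides meet because Span
   G_t and Ker M_s(L) agree on R[x]_s: kernel vectors of M_s(L) are in N_t by positivity, and
   conversely (B) keeps the multiples of an element of Span G_t in Span G_t, where L vanishes. *)
Require Import Defs.
From HB Require Import structures.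
From mathcomp Require Import all_boot all_order all_algebra.
From mathcomp Require Import boolp classical_sets reals.
From mathcomp Require Import ring lra.
Set Implicit Arguments.
Unset Strict Implicit.
Unset Printing Implicit Defensive.
Import Order.TTheory GRing.Theory Num.Theory.
Local Open Scope classical_set_scope.
Local Open Scope ring_scope.

(** * Strict separation for quadratic maps *)

(* The imports are confined to a module because the notations of
   mathcomp-analysis clash with those of mpoly. *)
Module Separation.
From mathcomp Require Import topology normedtype derive.
Import numFieldNormedType.Exports.

Section Separation.
Variable R : realType.

(** Squared Euclidean norm. Being a polynomial in the entries, it is continuous and expands exactly
    under a perturbation. *)
Definition sqnorm k l (w : 'M[R]_(k, l)) : R := \sum_i \sum_j w i j ^+ 2.

Lemma sqnorm_ge0 k l (w : 'M_(k, l)) : 0 <= sqnorm w.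
Proof. by do 2![apply: sumr_ge0 => ? _]; apply: sqr_ge0. Qed.

Lemma sqnorm_eq0 k l (w : 'M_(k, l)) : sqnorm w = 0 -> w = 0.
Proof.
move=> /eqP; rewrite psumr_eq0 => [/allP w0|i _]; last first.
  by apply: sumr_ge0 => j _; apply: sqr_ge0.
apply/matrixP => i j; have := w0 i (mem_index_enum i); rewrite /= psumr_eq0.
  by move=> /allP/(_ j (mem_index_enum j)); rewrite /= sqrf_eq0 mxE => /eqP.
by move=> ? _; apply: sqr_ge0.
Qed.

Lemma sqnormZ k l c (w : 'M_(k, l)) : sqnorm (c *: w) = c ^+ 2 * sqnorm w.
Proof.
rewrite mulr_sumr; apply: eq_bigr => i _; rewrite mulr_sumr.
by apply: eq_bigr => j _; rewrite mxE exprMn.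
Qed.

Lemma continuous_sum (T : topologicalType) I (r : seq I) (f : I -> T -> R) :
  (forall i, continuous (f i)) -> continuous (fun x => \sum_(i <- r) f i x).
Proof.
move=> fc x; elim: r => [|i r IH].
  by under eq_fun do rewrite big_nil; apply: cst_continuous.
under eq_fun do rewrite big_cons.
by apply: continuousD; [apply: fc | apply: IH].
Qed.

Lemma continuous_mul (T : topologicalType) (f g : T -> R) :
  continuous f -> continuous g -> continuous (fun x => f x * g x).
Proof. by move=> fc gc x; apply: continuousM; [apply: fc | apply: gc]. Qed.

(** The unit sphere is closed in the box with sides [[-1, 1]], hence compact, and [0 < k] makes it
    nonempty. *)
Lemma sphere_argmin k (f : 'rV[R]_k -> R) : (0 < k)%N -> continuous f ->
  exists2 c, sqnorm c = 1 & forall w, sqnorm w = 1 -> f c <= f w.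
Proof.
case: k f => // k f _ fc.
pose S := [set w : 'rV[R]_k.+1 | sqnorm w = 1].
have sqc : continuous (fun w : 'rV[R]_k.+1 => sqnorm w).
  do 2![apply: continuous_sum => ?].
  by apply: continuous_mul; apply: coord_continuous.
have S0 : S !=set0.
  exists (delta_mx 0 0); rewrite /S /= /sqnorm big_ord1 (bigD1 ord0) //= big1.
    by rewrite addr0 mxE !eqxx expr1n.
  by move=> i /negbTE i0; rewrite mxE i0 andbF expr0n.
have Sc : compact S.
  have boxc := @rV_compact _ _ (fun=> `[-1, 1]%classic : set R)
                (fun _ : 'I_k.+1 => @segment_compact R (-1) 1).
  apply: subclosed_compact boxc _.
    by apply: (preimage_closed (D := [set x : R | x = 1])) => [x _|];
      [apply: sqc | apply: closed_eq].
  move=> w wS i /=; rewrite in_itv /= -ler_norml -(@ler_pXn2r _ 2) ?nnegrE //.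
  rewrite expr1n real_normK ?num_real // -wS /sqnorm big_ord1.
  by rewrite (bigD1 i) //= lerDl sumr_ge0 // => ? _; apply: sqr_ge0.
have [c cS cmin] := EVT_min_rV S0 Sc (continuous_subspaceT fc).
by exists c => [|w wS]; [move: cS; rewrite inE | apply: cmin; rewrite inE].
Qed.

Variables (N M : nat) (a : 'I_N -> 'I_N -> 'rV[R]_M).

Definition quad (u v : 'rV[R]_N) : 'rV[R]_M :=
  \sum_i \sum_j (u 0 i * v 0 j) *: a i j.

Definition gram (B : 'M[R]_(N.+1, N)) : 'rV[R]_M :=
  \sum_k quad (row k B) (row k B).

Lemma quadDl u u' v : quad (u + u') v = quad u v + quad u' v.
Proof.
rewrite -big_split; apply: eq_bigr => i _; rewrite -big_split.
by apply: eq_bigr => j _; rewrite mxE mulrDl scalerDl.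
Qed.

Lemma quadDr u v v' : quad u (v + v') = quad u v + quad u v'.
Proof.
rewrite -big_split; apply: eq_bigr => i _; rewrite -big_split.
by apply: eq_bigr => j _; rewrite mxE mulrDr scalerDl.
Qed.

Lemma quadZl c u v : quad (c *: u) v = c *: quad u v.
Proof.
rewrite scaler_sumr; apply: eq_bigr => i _; rewrite scaler_sumr.
by apply: eq_bigr => j _; rewrite mxE -mulrA scalerA.
Qed.

Lemma quadZr c u v : quad u (c *: v) = c *: quad u v.
Proof.
rewrite scaler_sumr; apply: eq_bigr => i _; rewrite scaler_sumr.
by apply: eq_bigr => j _; rewrite mxE mulrCA scalerA.
Qed.

Lemma quad_suml I r (P : pred I) (F : I -> _) v :
  quad (\sum_(i <- r | P i) F i) v = \sum_(i <- r | P i) quad (F i) v.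
Proof.
apply: (big_morph (fun u => quad u v)) => [u u'|]; first exact: quadDl.
by rewrite -[0](scale0r (0 : 'rV__)) quadZl scale0r.
Qed.

Lemma quad_sumr I r (P : pred I) (F : I -> _) u :
  quad u (\sum_(i <- r | P i) F i) = \sum_(i <- r | P i) quad u (F i).
Proof.
apply: (big_morph (quad u)) => [v v'|]; first exact: quadDr.
by rewrite -[0](scale0r (0 : 'rV__)) quadZr scale0r.
Qed.

Lemma gramZ c B : gram (c *: B) = c ^+ 2 *: gram B.
Proof.
rewrite scaler_sumr; apply: eq_bigr => k _.
by rewrite linearZ /= quadZl quadZr scalerA expr2.
Qed.

(** The cross terms are values of [quad] at [u *m B] and [v], so they vanish and only the
    second-order term survives. *)
Lemma gram_perturb B (u : 'rV_N.+1) (v : 'rV_N) c : u *m B = 0 ->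
  gram (B + c *: (u^T *m v)) = gram B + (c ^+ 2 * sqnorm u) *: quad v v.
Proof.
move=> uB.
have rowE k : row k (B + c *: (u^T *m v)) = row k B + (c * u 0 k) *: v.
  apply/rowP => j; rewrite !mxE big_ord1 mxE; ring.
have uB' : \sum_k u 0 k *: row k B = 0.
  by rewrite -mulmx_sum_row.
rewrite /gram; under eq_bigr => k _ do
  rewrite rowE quadDl !quadDr !quadZl !quadZr -!addrA scalerA.
rewrite !big_split /=; congr (_ + _).
have -> : \sum_k (c * u 0 k) *: quad (row k B) v = 0.
  under eq_bigr => k _ do rewrite -scalerA -quadZl.
  rewrite -scaler_sumr -quad_suml uB' -[0](scale0r (0 : 'rV__)) quadZl.
  by rewrite !scale0r scaler0.
have -> : \sum_k (c * u 0 k) *: quad v (row k B) = 0.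
  under eq_bigr => k _ do rewrite -scalerA -quadZr.
  rewrite -scaler_sumr -quad_sumr uB' -[0](scale0r (0 : 'rV__)) quadZr.
  by rewrite !scale0r scaler0.
rewrite !add0r -scaler_suml; congr (_ *: _).
rewrite /sqnorm big_ord1 mulr_sumr; apply: eq_bigr => k _; ring.
Qed.

(** The inner product of [B] with [u^T *m v] is that of [u *m B] with [v], which is 0. *)
Lemma sqnorm_perturb (B : 'M[R]_(N.+1, N)) (u : 'rV_N.+1) (v : 'rV_N) c :
  u *m B = 0 ->
  sqnorm (B + c *: (u^T *m v)) = sqnorm B + c ^+ 2 * sqnorm u * sqnorm v.
Proof.
move=> uB.
have -> : sqnorm (B + c *: (u^T *m v)) = sqnorm B +
    \sum_j \sum_i 2 * c * v 0 j * (u 0 i * B i j) +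
    \sum_i \sum_j c ^+ 2 * u 0 i ^+ 2 * v 0 j ^+ 2.
  rewrite [X in _ + X + _]exchange_big -!big_split; apply: eq_bigr => i _.
  rewrite -!big_split; apply: eq_bigr => j _.
  by rewrite !mxE big_ord1 mxE /=; ring.
rewrite big1 ?addr0 => [|j _]; last first.
  rewrite -mulr_sumr; have := congr1 (fun w : 'rV_N => w 0 j) uB.
  by rewrite !mxE => ->; rewrite mulr0.
congr (_ + _); rewrite /sqnorm !big_ord1 -mulrA mulr_suml mulr_sumr.
by apply: eq_bigr => i _; rewrite !mulr_sumr; apply: eq_bigr => j _; rewrite mulrA.
Qed.

Lemma continuous_sqnorm_gram :
  continuous (fun w : 'rV[R]_(N.+1 * N) => sqnorm (gram (vec_mx w))).
Proof.
have cc k j : continuous (fun w : 'rV[R]_(N.+1 * N) => vec_mx w k j).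
  by move=> w; under eq_fun do rewrite mxE; apply: coord_continuous.
have gc i l : continuous (fun w : 'rV[R]_(N.+1 * N) => gram (vec_mx w) i l).
  suff -> : (fun w : 'rV[R]_(N.+1 * N) => gram (vec_mx w) i l) =
      fun w => \sum_k \sum_j \sum_j' vec_mx w k j * vec_mx w k j' * a j j' i l.
    do 3![apply: continuous_sum => ?].
    apply: continuous_mul; last by move=> ?; apply: cst_continuous.
    by apply: continuous_mul; apply: cc.
  apply/funext => w; rewrite summxE; apply: eq_bigr => k _.
  rewrite summxE; apply: eq_bigr => j _.
  by rewrite summxE; apply: eq_bigr => j' _; rewrite !mxE.
by do 2![apply: continuous_sum => ?]; apply: continuous_mul; apply: gc.
Qed.

(* The vector z is gram B for B minimising |gram B| on the unit sphere. As B
   has more rows than columns, u *m B = 0 for some u != 0, and perturbing B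
   along u^T *m v moves gram B in the direction quad v v. *)
Lemma strict_separation : (forall B, gram B = 0 -> B = 0) ->
  exists z : 'cV[R]_M, forall v, v != 0 -> 0 < (quad v v *m z) 0 0.
Proof.
move=> gram_inj; have [N0|N_gt0] := posnP N.
  exists 0 => v /negP[]; apply/eqP/rowP => i; exfalso.
  by case: i; rewrite N0.
have [|c c1 cmin] := sphere_argmin _ continuous_sqnorm_gram.
  by rewrite muln_gt0 N_gt0.
set B := vec_mx c in cmin; set Z := gram B in cmin.
have sq_vec w : sqnorm (vec_mx w : 'M[R]_(N.+1, N)) = sqnorm w.
  rewrite /sqnorm big_ord1 (reindex _ (curry_mxvec_bij _ _)) /=.
  rewrite pair_bigA; apply: eq_bigr => -[i j] _ /=.
  by rewrite mxE.
have B1 : sqnorm B = 1 by rewrite sq_vec.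
(* Minimality in homogeneous form: [gram] is quadratic, so the squared norm of [gram C] scales like
   [sqnorm C ^+ 2]. *)
have minB C : sqnorm Z * sqnorm C ^+ 2 <= sqnorm (gram C).
  have [->|C_neq0] := eqVneq (sqnorm C) 0.
    by rewrite expr0n mulr0 sqnorm_ge0.
  have C_gt0 : 0 < sqnorm C by rewrite lt_def C_neq0 sqnorm_ge0.
  have sqC : Num.sqrt (sqnorm C) ^+ 2 = sqnorm C by rewrite sqr_sqrtr ?ltW.
  have := cmin (mxvec ((Num.sqrt (sqnorm C))^-1 *: C)).
  rewrite -sq_vec mxvecK sqnormZ exprVn sqC mulVf // => /(_ erefl).
  rewrite gramZ sqnormZ exprVn sqC exprVn mulrC ler_pdivlMr //.
  by rewrite exprn_gt0.
have Z_gt0 : 0 < sqnorm Z.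
  rewrite lt_def sqnorm_ge0 andbT; apply/eqP => /sqnorm_eq0/gram_inj B0.
  move: B1; rewrite B0 -[0](scale0r B) sqnormZ expr0n mul0r.
  by move=> /esym/eqP; rewrite oner_eq0.
have [u u_neq0 uB] : exists2 u : 'rV_N.+1, u != 0 & u *m B = 0.
  have : kermx B != 0.
    by rewrite -mxrank_eq0 mxrank_ker subn_eq0 -ltnNge ltnS rank_leq_col.
  move=> /rowV0Pn[u u_ker u_neq0]; exists u => //.
  exact: (sub_kermxP u_ker).
exists Z^T => v v_neq0; rewrite ltNge; apply/negP => Zv.
have pos (k : nat) (w : 'rV[R]_k) : w != 0 -> 0 < sqnorm w.
  move=> w0; rewrite lt_def sqnorm_ge0 andbT; apply: contra w0 => /eqP/sqnorm_eq0 ->.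
  by [].
have [u_gt0 v_gt0] := (pos _ _ u_neq0, pos _ _ v_neq0).
(* Both perturbation formulas depend on [c] only through [e c], which takes every nonnegative value
   since [u != 0]. *)
pose e c := c ^+ 2 * sqnorm u.
have ineq c' : sqnorm Z * (1 + e c' * sqnorm v) ^+ 2 <=
    sqnorm Z + 2 * e c' * (quad v v *m Z^T) 0 0 + e c' ^+ 2 * sqnorm (quad v v).
  have := minB (B + c' *: (u^T *m v)).
  rewrite sqnorm_perturb // gram_perturb // B1.
  suff -> : sqnorm (Z + (c' ^+ 2 * sqnorm u) *: quad v v) =
     sqnorm Z + 2 * e c' * (quad v v *m Z^T) 0 0 + e c' ^+ 2 * sqnorm (quad v v).
    by [].
  rewrite -/(e c') mxE; move: (e c') => x.
  rewrite /sqnorm !big_ord1 !mulr_sumr -!big_split.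
  by apply: eq_bigr => j _; rewrite !mxE /=; ring.
(* By [Zv] the cross term is at most 0; it is dropped together with the square of [e c' * sqnorm v].
   What remains fails for small positive [e c']. *)
have {}ineq c' : 0 <= e c' * (e c' * sqnorm (quad v v) - 2 * sqnorm Z * sqnorm v).
  have := ineq c'; have : 0 <= e c' by rewrite mulr_ge0 ?sqr_ge0 ?ltW.
  have := mulr_ge0 (sqr_ge0 (e c' * sqnorm v)) (ltW Z_gt0).
  move: (e c') (sqnorm v) (sqnorm Z) (sqnorm (quad v v)).
  by move: ((quad v v *m Z^T) 0 0) Zv => *; nra.
(* The [+ 1] keeps the denominator positive. [x] is the square of a [c'] for which [e c'] equals
   [sqnorm Z * sqnorm v / q], small enough to make the last factor negative. *)
pose q := sqnorm (quad v v) + 1.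
have q_gt0 : 0 < q by rewrite ltr_wpDl ?sqnorm_ge0.
pose x := sqnorm Z * sqnorm v / (q * sqnorm u).
have x_gt0 : 0 < x by rewrite divr_gt0 ?mulr_gt0.
have ex : e (Num.sqrt x) = sqnorm Z * sqnorm v / q.
  rewrite /e sqr_sqrtr ?ltW // /x; field.
  by rewrite ?gt_eqF.
have := ineq (Num.sqrt x); rewrite ex leNgt => /negP[].
rewrite pmulr_rlt0 ?divr_gt0 ?mulr_gt0 // subr_lt0 mulrAC ltr_pdivrMr //.
have := mulr_gt0 Z_gt0 v_gt0; have := sqnorm_ge0 (quad v v).
rewrite /q; move: (sqnorm Z) (sqnorm v) (sqnorm (quad v v)) => A b d; nra.
Qed.

End Separation.
End Separation.

From mathcomp Require Import ssrcomplements mpoly.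

(** * Linear sets of polynomials and their codimensions *)

Section LinearSets.
Variables (K : fieldType) (V : lmodType K).
Implicit Types S T : set V.

Definition linear_set S : Prop :=
  S 0 /\ forall a u v, S u -> S v -> S (a *: u + v).

Lemma linear_setD S u v : linear_set S -> S u -> S v -> S (u + v).
Proof. by move=> [_ SD] Su Sv; rewrite -[u]scale1r; apply: SD. Qed.

Lemma linear_setZ S a u : linear_set S -> S u -> S (a *: u).
Proof. by move=> [S0 SD] Su; rewrite -[_ *: _]addr0; apply: SD. Qed.

Lemma linear_setN S u : linear_set S -> S u -> S (- u).
Proof. by move=> lS Su; rewrite -scaleN1r; apply: linear_setZ. Qed.

Lemma linear_setB S u v : linear_set S -> S u -> S v -> S (u - v).
Proof. by move=> lS Su Sv; apply: linear_setD => //; apply: linear_setN. Qed.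

Lemma linear_setBC S u v : linear_set S -> S (u - v) -> S (v - u).
Proof. by move=> lS /(linear_setN lS); rewrite opprB. Qed.

Lemma linear_set_trans S u v w :
  linear_set S -> S (u - v) -> S (v - w) -> S (u - w).
Proof. by move=> lS Suv /(linear_setD lS Suv); rewrite addrA subrK. Qed.

Lemma linear_set_sum S I (r : seq I) (P : pred I) (F : I -> V) :
  linear_set S -> (forall i, P i -> S (F i)) -> S (\sum_(i <- r | P i) F i).
Proof.
by move=> lS SF; elim/big_ind: _ => // [|u v]; [case: lS | apply: linear_setD].
Qed.

Lemma linear_setI S T : linear_set S -> linear_set T -> linear_set (S `&` T).
Proof.
move=> [S0 SD] [T0 TD]; split=> // a u v [Su Tu] [Sv Tv].
by split; [apply: SD | apply: TD].
Qed.

Lemma sub_lin_span S : S `<=` lin_span S.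
Proof.
move=> p Sp; exists 1%N, (fun=> 1), (fun=> p); split=> //.
by rewrite big_ord1 scale1r.
Qed.

Lemma lin_span_linear S : linear_set (lin_span S).
Proof.
split=> [|a _ _ [k [c [g [Sg ->]]]] [k' [c' [g' [Sg' ->]]]]].
  by exists 0%N, (fun=> 0), (fun=> 0); rewrite big_ord0; split=> // -[].
pose join (X : Type) (f : 'I_k -> X) (f' : 'I_k' -> X) i :=
  match split i with inl j => f j | inr j => f' j end.
exists (k + k')%N, (join K (fun i => a * c i) c'), (join V g g'); split.
  by move=> i; rewrite /join; case: (split i).
rewrite big_split_ord /= scaler_sumr; congr (_ + _); apply: eq_bigr => i _.
  by rewrite /join (unsplitK (inl i)) scalerA.
by rewrite /join (unsplitK (inr i)).
Qed.

Lemma lin_span_min S T : linear_set T -> S `<=` T -> lin_span S `<=` T.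
Proof.
move=> lT ST _ [k [c [g [Sg ->]]]].
by apply: linear_set_sum => // i _; apply: linear_setZ => //; apply: ST.
Qed.

Lemma lin_span_sub S T : S `<=` T -> lin_span S `<=` lin_span T.
Proof.
move=> ST; apply: lin_span_min; first exact: lin_span_linear.
by move=> p /ST; apply: sub_lin_span.
Qed.

End LinearSets.

Section DegreeBounds.
Variables (n : nat) (R : realType).
Implicit Types (S T : set {mpoly R[n]}) (p q : {mpoly R[n]}).

Lemma polys_le_linear t : linear_set (@polys_le n R t).
Proof.
split=> [|c p q]; rewrite /polys_le /= ?msize0 // => hp hq.
apply: leq_trans (msizeD_le _ _) _; rewrite geq_max hq andbT.
exact: leq_trans (msizeZ_le _ _) hp.
Qed.

Lemma polys_leW s t p : (s <= t)%N -> polys_le s p -> polys_le t p.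
Proof. by move=> st /= ps; apply: leq_trans ps _; rewrite ltnS. Qed.

Lemma polys_le_X t m : polys_le t ('X_[m] : {mpoly R[n]}) <-> (mdeg m <= t)%N.
Proof. by rewrite /polys_le /= msizeX ltnS. Qed.

Lemma polys_le_X1 t i : (0 < t)%N -> polys_le t ('X_i : {mpoly R[n]}).
Proof. by move=> t0; apply/polys_le_X; rewrite mdeg1. Qed.

Lemma polys_le1 t : polys_le t (1 : {mpoly R[n]}).
Proof. by rewrite -mpolyX0; apply/polys_le_X; rewrite mdeg0. Qed.

Lemma polys_leM s t p q :
  polys_le s p -> polys_le t q -> polys_le (s + t) (p * q).
Proof.
have [->|p0] := eqVneq p 0.
  by rewrite mul0r => _ _; case: (polys_le_linear (s + t)).
have [->|q0] := eqVneq q 0.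
  by rewrite mulr0 => _ _; case: (polys_le_linear (s + t)).
rewrite /polys_le /= msizeM // => hp hq.
apply: leq_trans (_ : (s.+1 + t.+1).-1 <= _)%N; last by rewrite addnS.
rewrite -!subn1; apply: leq_sub2r; exact: leq_add.
Qed.

Lemma polys_le_sqr s p : polys_le s p -> polys_le s.*2 (p ^+ 2).
Proof. by move=> ps; rewrite expr2 -addnn; apply: polys_leM. Qed.

Lemma polys_le_msize p : polys_le (msize p) p.
Proof. exact: leqnSn. Qed.

Lemma polys_le_mpoly_le t (x : mpoly_le n R t) : polys_le t (val x).
Proof. exact: (valP x). Qed.

Lemma linear_set_poly T t p : linear_set T -> polys_le t p ->
  (forall m, (mdeg m <= t)%N -> T 'X_[m]) -> T p.
Proof.
move=> lT pt TX; rewrite [p](mpolywE pt); apply: linear_set_sum => // m _.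
by apply: linear_setZ => //; apply: TX; rewrite -ltnS bmdeg.
Qed.

Lemma linear_set_all T p : linear_set T -> (forall m, T 'X_[m]) -> T p.
Proof. by move=> lT TX; apply: (linear_set_poly lT (polys_le_msize p)). Qed.

Lemma mnm_succ d (m : 'X_{1..n}) : mdeg m = d.+1 ->
  exists i m', m = (U_(i) + m')%MM /\ mdeg m' = d.
Proof.
move=> md; have /existsP[i mi] : [exists i, m i != 0]%N.
  apply/contraT => /existsPn m0; move: md; rewrite mdegE big1 // => i _.
  by apply/eqP; rewrite -[_ == _]negbK m0.
have le : (U_(i) <= m)%MM.
  by apply/mnm_lepP => j; rewrite mnm1E; case: eqP => // <-; rewrite lt0n.
exists i, (m - U_(i))%MM; split; first by rewrite addmC submK.
by apply/succn_inj; rewrite -md -(submK le) mdegD mdeg1 addn1 addmK.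
Qed.

Lemma mnm_ind (P : 'X_{1..n} -> Prop) : P 0%MM ->
  (forall i m, P m -> P (U_(i) + m)%MM) -> forall m, P m.
Proof.
move=> P0 PS m; move: {2}(mdeg m) (erefl (mdeg m)) => d.
elim: d m => [m /eqP|d IH m /mnm_succ[i [m' [-> /IH]]]]; last exact: PS.
by rewrite mdeg_eq0 => /eqP->.
Qed.

Lemma mnm_split a b (m : 'X_{1..n}) : (mdeg m <= a + b)%N ->
  exists m1 m2, [/\ m = (m1 + m2)%MM, (mdeg m1 <= a)%N & (mdeg m2 <= b)%N].
Proof.
elim/mnm_ind: m a => [|i m IH] a.
  by exists 0%MM, 0%MM; rewrite addm0 mdeg0.
rewrite mdegD mdeg1; case: a => [|a] hm.
  by exists 0%MM, (U_(i) + m)%MM; rewrite add0m mdeg0 mdegD mdeg1.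
have [m1 [m2 [-> h1 h2]]] := IH a hm.
by exists (U_(i) + m1)%MM, m2; rewrite addmA mdegD mdeg1.
Qed.

End DegreeBounds.

Section Codimension.
Variables (n : nat) (R : realType).
Implicit Types (S G : set {mpoly R[n]}).

(** Moves a linear set of polynomials, cut at degree [u], into the type of subspaces, where
    dimensions live. The default 0 is taken only when [S] is not linear. *)
Definition vle u S : {vspace mpoly_le n R u} :=
  xget 0%VS [set U : {vspace mpoly_le n R u} |
    [set` U] = [set x : mpoly_le n R u | S (val x)]].

Lemma vleP u S x : linear_set S -> x \in vle u S <-> S (val x).
Proof.
move=> [S0 SD]; rewrite /vle; case: xgetP => [U _ /= US|noU].
  by have /= -> := congr1 (fun A : set _ => A x) US.
have [|a p q Sp Sq|U US] := @subspace_vspace R (mpoly_le n R u)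
    [set x : mpoly_le n R u | S (val x)].
- by [].
- exact: SD.
- by case: (noU U).
Qed.

(** For [S] the span of G this is the dimension of pi_u(G^perp), see [dim_restr_perpE]; the
    conditions (A) and (B) become comparisons of codimensions. *)
Definition codim u S : nat := (\dim {: mpoly_le n R u} - \dim (vle u S))%N.

Definition incl u v (x : mpoly_le n R u) : mpoly_le n R v := insubd 0 (val x).

Lemma val_insubd v p : polys_le v p -> val (insubd (0 : mpoly_le n R v) p) = p.
Proof. by move=> pv; apply: insubdK. Qed.

Lemma val_incl u v x : (u <= v)%N -> val (@incl u v x) = val x.
Proof. by move=> uv; apply/val_insubd/(polys_leW uv)/polys_le_mpoly_le. Qed.

Lemma incl_linear u v : (u <= v)%N -> linear (@incl u v).
Proof.
move=> uv a x y; apply: val_inj; rewrite val_incl //.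
by rewrite [RHS]/= -/(val (incl v x)) -/(val (incl v y)) !val_incl.
Qed.

Lemma incl_lfun u v : (u <= v)%N ->
  exists f : 'Hom(mpoly_le n R u, mpoly_le n R v),
    (forall x, val (f x) = val x) /\ lker f == 0%VS.
Proof.
move=> uv; pose L := GRing.isLinear.Build _ _ _ _ _ (incl_linear uv).
pose g : {linear _ -> _} := HB.pack (@incl u v) L.
have fE x : val (linfun g x) = val x by rewrite lfunE /= val_incl.
exists (linfun g); split=> //; apply/lker0P => x y /(congr1 val).
by rewrite !fE => /val_inj.
Qed.

Lemma codim_le_add u S : (codim u S + \dim (vle u S) = \dim {: mpoly_le n R u})%N.
Proof. by rewrite subnK // dimvS // subvf. Qed.

Lemma dim_limg_add_vle u v S (f : 'Hom(mpoly_le n R u, mpoly_le n R v)) :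
  linear_set S -> (forall x, val (f x) = val x) -> lker f == 0%VS ->
  \dim (limg f + vle v S) = (codim u S + \dim (vle v S))%N.
Proof.
move=> lS fE f0.
have dimT : \dim (limg f) = \dim {: mpoly_le n R u}.
  by apply: limg_dim_eq; rewrite (eqP f0) capv0.
have capT : \dim (limg f :&: vle v S) = \dim (vle u S).
  rewrite -(@limg_dim_eq _ _ _ f (vle u S)) ?(eqP f0) ?capv0 //.
  congr (\dim _); apply/vspaceP => x; apply/memv_capP/memv_imgP.
    move=> [/memv_imgP[y _ ->] /vleP]; rewrite fE => Sy.
    by exists y => //; apply/vleP => //; apply: Sy.
  move=> [y /vleP yS ->]; split; first by rewrite memv_img ?memvf.
  by apply/vleP; rewrite ?fE //; apply: yS.
have := dimv_sum_cap (limg f) (vle v S).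
by rewrite capT dimT -(codim_le_add u S) addnAC => /addIn.
Qed.

(** By [dim_limg_add_vle] the codimension at [u] is the dimension of R[x]_u + S minus that of S,
    inside R[x]_v; equality therefore says that the sum fills R[x]_v. *)
Lemma codim_eq u v S : (u <= v)%N -> linear_set S ->
  codim u S = codim v S <->
  (forall p, polys_le v p -> exists2 q, polys_le u q & S (p - q)).
Proof.
move=> uv lS; have [f [fE f0]] := incl_lfun uv.
have := dim_limg_add_vle lS fE f0; set T := limg f => dsum.
have -> : codim u S = codim v S <-> (T + vle v S = fullv)%VS.
  have dv := codim_le_add v S; split=> E.
    by apply/eqP; rewrite eqEdim subvf -dv -E dsum leqnn.
  by apply: (@addIn (\dim (vle v S))); rewrite -dsum dv E.
split=> [sumT p pv|red].
  have : insubd (0 : mpoly_le n R v) p \in (T + vle v S)%VS.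
    by rewrite sumT memvf.
  move=> /memv_addP[_ /memv_imgP[x _ ->] [y /vleP yS /(congr1 val)]].
  rewrite val_insubd // => ->; exists (val x); first exact: polys_le_mpoly_le.
  rewrite -fE -[val (_ + _)]/(val (f x) + val y) addrC addKr.
  exact: yS.
apply/vspaceP => x; rewrite memvf.
have [q qu Sq] := red _ (polys_le_mpoly_le x).
have -> : x = f (insubd 0 q) + (x - f (insubd 0 q)) by rewrite addrC subrK.
rewrite memv_add ?memv_img ?memvf //; apply/vleP => //.
by rewrite -[val _]/(val x - val (f _)) fE val_insubd.
Qed.

(** The annihilator is the kernel of the restriction of functionals to [U], which is onto because a
    functional on [U] extends through the projection [vsproj]. *)
Lemma dim_annihilator (V : vectType R) (U : {vspace V}) :
  exists A : {vspace 'Hom(V, R^o)},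
    (forall f, (f \in A) = (U <= lker f)%VS) /\ (\dim A + \dim U = \dim {: V})%N.
Proof.
pose i : 'Hom(subvs_of U, V) := linfun vsval.
pose r (f : 'Hom(V, R^o)) : 'Hom(subvs_of U, R^o) := (f \o i)%VF.
have r_lin : linear r by move=> a f g; rewrite /r comp_lfunDl comp_lfunZl.
pose rL : {linear _ -> _} := HB.pack r (GRing.isLinear.Build _ _ _ _ _ r_lin).
have rE f : linfun rL f = (f \o i)%VF by rewrite lfunE.
have dim_dual (W : vectType R) : \dim {: 'Hom(W, R^o)} = \dim {: W}.
  by rewrite !dimvf /dim /= muln1.
exists (lker (linfun rL)); split=> [f|].
  rewrite memv_ker rE; apply/eqP/subvP => [fi0 x xU|Uf].
    have := congr1 (fun g : 'Hom(_, _) => g (vsproj U x)) fi0.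
    by rewrite comp_lfunE lfunE /= vsprojK // zero_lfunE memv_ker => ->.
  apply/lfunP => x; rewrite comp_lfunE lfunE zero_lfunE /=.
  by apply/eqP; rewrite -memv_ker; apply/Uf/subvsP.
have -> : \dim U = \dim (limg (linfun rL)).
  have -> : limg (linfun rL) = fullv.
    apply/vspaceP => g; rewrite memvf; apply/memv_imgP.
    exists (g \o linfun (vsproj U))%VF; rewrite ?memvf // rE.
    by apply/lfunP => x; rewrite !comp_lfunE !lfunE /= vsvalK.
  by rewrite dim_dual dimvf.
by rewrite -[RHS]dim_dual -(limg_ker_dim (linfun rL) fullv) capfv.
Qed.

Lemma leval_val t (L : dual_le n R t) (x : mpoly_le n R t) :
  leval L (val x) = L x.
Proof.
congr (L _); apply: val_inj; rewrite val_insubd //.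
exact: polys_le_mpoly_le.
Qed.

Lemma levalP t (L : dual_le n R t) a p q : polys_le t p -> polys_le t q ->
  leval L (a *: p + q) = a * leval L p + leval L q.
Proof.
move=> pt qt; rewrite -[RHS]linearP; congr (L _); apply: val_inj.
rewrite -[RHS]/(a *: val (insubd _ p) + val (insubd _ q)) !val_insubd //.
by case: (polys_le_linear n R t) => _; apply.
Qed.

Lemma leval0 t (L : dual_le n R t) : leval L 0 = 0.
Proof. by have := leval_val L 0; rewrite !linear0. Qed.

Lemma perp_lin_span t G (L : dual_le n R t) p : G `<=` polys_le t ->
  perp t G L -> lin_span G p -> leval L p = 0.
Proof.
move=> Gt LG Gp.
have [p0 pD] := polys_le_linear n R t.
suff /(_ _ Gp)[] : lin_span G `<=` [set p | polys_le t p /\ leval L p = 0] by [].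
apply: lin_span_min => [|q Gq]; last first.
  split; first exact: Gt.
  by apply: LG; rewrite -[mpoly_of_le _]/(val _) val_insubd //; apply: Gt.
split=> [|a q q' [qt Lq] [qt' Lq']]; first by rewrite /= leval0.
by split; [apply: pD | rewrite levalP // Lq Lq' mulr0 addr0].
Qed.

(** Restriction to R[x]_u maps the annihilator of Span G, and its kernel there is the annihilator of
    R[x]_u + Span G; the difference of their dimensions is the codimension. *)
Lemma dim_restr_perpE u t G : (u <= t)%N -> G `<=` polys_le t ->
  dim_restr_perp u t G = codim u (lin_span G).
Proof.
move=> ut Gt; have [f [fE f0]] := incl_lfun ut.
have lG := @lin_span_linear _ _ G.
have restrE (L : dual_le n R t) : restr u L = (L \o f)%VF.
  have -> : restr u L = linfun (L \o f)%VF.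
    congr linfun; apply/funext => x; rewrite comp_lfunE /leval; congr (L _).
    apply: val_inj; rewrite fE val_insubd //.
    exact/(polys_leW ut)/polys_le_mpoly_le.
  exact: fun_of_lfunK.
set S := vle t (lin_span G).
have [A [memA dimA]] := dim_annihilator S.
have [B [memB dimB]] := dim_annihilator (limg f + S).
pose r (L : dual_le n R t) : dual_le n R u := (L \o f)%VF.
have r_lin : linear r by move=> a g h; rewrite /r comp_lfunDl comp_lfunZl.
pose rL : {linear _ -> _} := HB.pack r (GRing.isLinear.Build _ _ _ _ _ r_lin).
have rE L : linfun rL L = (L \o f)%VF by rewrite lfunE.
have perpA : perp t G = [set` A].
  apply/seteqP; split=> [L LG|L] /=; rewrite memA.
    apply/subvP => x /vleP xS; rewrite memv_ker; apply/eqP.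
    rewrite -leval_val; apply: perp_lin_span Gt LG _; exact: xS.
  move=> /subvP SL p Gp; apply/eqP; rewrite -memv_ker; apply: SL.
  by apply/vleP => //; apply: sub_lin_span.
have -> : dim_restr_perp u t G = \dim (linfun rL @: A).
  rewrite /dim_restr_perp perpA -set_dimE; congr set_dim.
  apply/seteqP; split=> [_ [L LA <-]|_ /memv_imgP[L LA ->]] /=.
    by rewrite restrE -rE memv_img.
  by exists L; rewrite // restrE rE.
have capA : (A :&: lker (linfun rL))%VS = B.
  apply/vspaceP => L; rewrite memv_cap memA memB memv_ker rE subv_add andbC.
  congr (_ && _); rewrite lkerE; apply/eqP/eqP => [Lf|/eqP].
    by rewrite -limg_comp Lf lim0g.
  rewrite -limg_comp -lkerE => /subvP Lf; apply/lfunP => x.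
  by apply/eqP; rewrite zero_lfunE -memv_ker; apply: Lf; apply: memvf.
have := limg_ker_dim (linfun rL) A; rewrite capA.
have := dim_limg_add_vle lG fE f0; rewrite -/S => dsum.
move: dimA dimB; rewrite dsum => <- E E'.
by move: E; rewrite -E' addnA => /addIn/addnI.
Qed.

End Codimension.

(** * Moment matrices as bilinear forms on polynomials *)

Section Functionals.
Variables (n : nat) (R : realType).
Implicit Types (l : {scalar {mpoly R[n]}}) (p q : {mpoly R[n]}).

Definition nonneg s (l : {mpoly R[n]} -> R) : Prop :=
  forall p, polys_le s p -> 0 <= l (p ^+ 2).

(** The radical of the bilinear form sending [p], [q] to [l (p * q)] on R[x]_s, not the radical of
    an ideal. [ker_momentE] identifies it with Ker M_s. *)
Definition radical s (l : {mpoly R[n]} -> R) : set {mpoly R[n]} :=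
  [set p | polys_le s p /\ forall q, polys_le s q -> l (p * q) = 0].

Lemma radical_linear s l : linear_set (radical s l).
Proof.
have [p0 pD] := polys_le_linear n R s; split=> [|a p q [ps lp] [qs lq]].
  by split=> // q _; rewrite mul0r linear0.
split=> [|r rs]; first exact: pD.
by rewrite mulrDl -scalerAl linearP lp ?lq //= mulr0 addr0.
Qed.

Lemma radicalP s l p : radical s l p <->
  polys_le s p /\ forall m, (mdeg m <= s)%N -> l (p * 'X_[m]) = 0.
Proof.
split=> -[ps lp]; split=> //.
  by move=> m ms; apply: lp; apply/polys_le_X.
move=> q qs.
apply: (@linear_set_poly n R [set q | l (p * q) = 0] s q) => //.
split=> [|a u v]; rewrite /= ?mulr0 ?linear0 // => lu lv.
by rewrite mulrDr -scalerAr linearP lu lv /= mulr0 addr0.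
Qed.

Lemma nonnegW s s' l : (s <= s')%N -> nonneg s' l -> nonneg s l.
Proof. by move=> ss' l0 p ps; apply: l0; apply: polys_leW ps. Qed.

(** Cauchy-Schwarz: if [l (p ^+ 2) = 0], then [l ((a *: p + q) ^+ 2)] is affine in [a] and bounded
    below, so its slope is 0. *)
Lemma radical_sqr s l p : nonneg s l -> polys_le s p ->
  radical s l p <-> l (p ^+ 2) = 0.
Proof.
move=> l0 ps; split=> [[_ lp]|lp]; first by rewrite expr2 lp.
split=> // q qs; have [_ pD] := polys_le_linear n R s.
have ineq a : 0 <= l (q ^+ 2) + 2 * a * l (p * q).
  have -> : l (q ^+ 2) + 2 * a * l (p * q) = l ((a *: p + q) ^+ 2).
    by rewrite sqrrD exprZn -scalerAl mulr2n !raddfD /= !linearZ /= lp; ring.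
  by apply/l0/pD.
apply/eqP/negP => /negP nz.
(* This value of [a] makes the affine expression equal to -1. *)
have := ineq (- (l (q ^+ 2) + 1) / (2 * l (p * q))).
have -> : 2 * (- (l (q ^+ 2) + 1) / (2 * l (p * q))) * l (p * q) = - (l (q ^+ 2) + 1).
  by field; rewrite nz.
by lra.
Qed.

(** For nonnegative [l], membership is the equation [l (p ^+ 2) = 0], which does not mention the
    degree bound. *)
Lemma radicalW s s' l p : (s <= s')%N -> nonneg s' l -> polys_le s p ->
  radical s l p <-> radical s' l p.
Proof.
move=> ss' l0 ps; rewrite radical_sqr ?radical_sqr //; first exact: polys_leW ps.
exact: nonnegW l0.
Qed.

Section Mfun.
Variables (t : nat) (L : dual_le n R t).

Definition mfun p : R := \sum_(m : 'X_{1..n < t.+1}) p@_m * leval L 'X_[m].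

Lemma mfun_is_scalar : scalar mfun.
Proof.
move=> a p q; rewrite mulr_sumr -big_split; apply: eq_bigr => m _.
by rewrite mcoeffD mcoeffZ mulrDl mulrA.
Qed.

HB.instance Definition _ := GRing.isLinear.Build _ _ _ _ _ mfun_is_scalar.

Lemma mfunE p : polys_le t p -> leval L p = mfun p.
Proof.
move=> pt; rewrite {1}[p](mpolywE pt).
suff : forall r : seq 'X_{1..n < t.+1}, leval L (\sum_(m <- r) p@_m *: 'X_[m]) =
   \sum_(m <- r) p@_m * leval L 'X_[m] by move=> ->.
elim=> [|m r IH]; first by rewrite !big_nil leval0.
rewrite !big_cons levalP ?IH //.
  by apply/polys_le_X; rewrite -ltnS bmdeg.
apply: linear_set_sum => [|k _]; first exact: polys_le_linear.
apply: linear_setZ; first exact: polys_le_linear.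
by apply/polys_le_X; rewrite -ltnS bmdeg.
Qed.

End Mfun.

Definition trunc t l : dual_le n R t := linfun (fun x : mpoly_le n R t => l (val x) : R^o).

Lemma leval_trunc t l p : polys_le t p -> leval (trunc t l) p = l p.
Proof.
move=> pt; pose g (x : mpoly_le n R t) : R^o := l (val x).
have g_lin : linear g by move=> a x y; rewrite /g !linearP.
pose gL : {linear _ -> _} := HB.pack g (GRing.isLinear.Build _ _ _ _ _ g_lin).
rewrite /leval /trunc -[X in linfun X]/(gL : _ -> _) lfunE /= /g.
by rewrite val_insubd.
Qed.

Section MomentMatrices.
Variable s : nat.
Local Notation N := #|{: 'X_{1..n < s.+1}}|.

Lemma bmon_le (i : 'I_N) : (mdeg (@bmon n s i) <= s)%N.
Proof. by rewrite -ltnS bmdeg. Qed.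

Lemma bmon_inj : injective (@bmon n s).
Proof. by move=> i j /val_inj/enum_val_inj. Qed.

Lemma bmon_surj m : (mdeg m <= s)%N -> exists i, @bmon n s i = m.
Proof.
by rewrite -ltnS => ms; exists (enum_rank (BMultinom ms)); rewrite /bmon enum_rankK.
Qed.

Definition row_poly (u : 'rV[R]_N) : {mpoly R[n]} := \sum_i u 0 i *: 'X_[bmon i].

Lemma row_poly_le u : polys_le s (row_poly u).
Proof.
apply: linear_set_sum => [|i _]; first exact: polys_le_linear.
by apply: linear_setZ; [apply: polys_le_linear | apply/polys_le_X/bmon_le].
Qed.

Lemma mcoeff_row_poly u j : (row_poly u)@_(bmon j) = u 0 j.
Proof.
rewrite raddf_sum /= (bigD1 j) //= mcoeffZ mcoeffX eqxx mulr1.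
rewrite big1 ?addr0 // => i ij; rewrite mcoeffZ mcoeffX (inj_eq bmon_inj).
by rewrite (negbTE ij) mulr0.
Qed.

Lemma row_polyK p : polys_le s p -> row_poly (\row_i p@_(bmon i)) = p.
Proof.
move=> ps; apply/mpolyP => m; have [ms|ms] := leqP (mdeg m) s.
  by have [i <-] := bmon_surj ms; rewrite mcoeff_row_poly mxE.
have z q : polys_le s q -> q@_m = 0.
  by move=> qs; apply/memN_msupp_eq0/msize_mdeg_ge; apply: leq_trans ms.
by rewrite !z //; apply: row_poly_le.
Qed.

Variables (t : nat) (L : dual_le n R t).
Hypothesis st : (s.*2 <= t)%N.

Lemma moment_mxE i j : moment_mx s L i j = mfun L ('X_[bmon i] * 'X_[bmon j]).
Proof.
rewrite mxE mfunE -?mpolyXD //; apply/polys_le_X.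
rewrite mdegD; apply: leq_trans st; rewrite -addnn; apply: leq_add; exact: bmon_le.
Qed.

Lemma trmx_moment : (moment_mx s L)^T = moment_mx s L.
Proof. by apply/matrixP => i j; rewrite !mxE addmC. Qed.

Lemma mul_row_moment u j :
  (u *m moment_mx s L) 0 j = mfun L (row_poly u * 'X_[bmon j]).
Proof.
rewrite mxE mulr_suml raddf_sum; apply: eq_bigr => i _.
by rewrite /= -scalerAl linearZ moment_mxE.
Qed.

Lemma quad_moment u v :
  (u *m moment_mx s L *m v^T) 0 0 = mfun L (row_poly u * row_poly v).
Proof.
rewrite mxE mulr_sumr raddf_sum; apply: eq_bigr => j _.
by rewrite /= -scalerAr linearZ mul_row_moment mxE mulrC.
Qed.

Lemma mul_row_moment_eq0 u :
  u *m moment_mx s L = 0 <-> radical s (mfun L) (row_poly u).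
Proof.
rewrite radicalP; split=> [uM|[_ uM]].
  split=> [|m ms]; first exact: row_poly_le.
  have [j <-] := bmon_surj ms.
  by rewrite /= -mul_row_moment uM mxE.
apply/rowP => j; rewrite mul_row_moment mxE; exact/uM/bmon_le.
Qed.

Lemma ker_momentE : ker_moment s L = radical s (mfun L).
Proof.
have mulE p : (\row_i p@_(bmon i) *m moment_mx s L = 0) <->
    (moment_mx s L *m \col_i p@_(bmon i) = 0).
  have -> : \col_i p@_(bmon i) = (\row_i p@_(bmon i))^T :> 'cV[R]_N.
    by apply/matrixP => i j; rewrite !mxE.
  rewrite -{2}trmx_moment -trmx_mul; split=> [->|/(congr1 trmx)].
    exact: trmx0.
  by rewrite trmxK trmx0.
apply/seteqP; split=> [p [ps /mulE]|p pr].
  by rewrite mul_row_moment_eq0 row_polyK.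
have ps := pr.1; split=> //.
by apply/mulE; rewrite mul_row_moment_eq0 row_polyK.
Qed.

Lemma psd_momentE : psd (moment_mx s L) <-> nonneg s (mfun L).
Proof.
split=> [[_ M0] p ps|l0].
  have := M0 (\row_i p@_(bmon i))^T.
  by rewrite trmxK quad_moment row_polyK // expr2.
split; first exact: trmx_moment.
move=> v; rewrite -[X in _ *m X]trmxK quad_moment -expr2.
exact/l0/row_poly_le.
Qed.

End MomentMatrices.

(** [M_u] is [P *m M *m P^T] for the matrix [P] selecting the monomials of degree at most [u], and
    the reduction says that the rows of [M] are spanned by those of [P *m M]. Symmetry of [M] turns
    such a relation on rows into one on columns, so passing from [P *m M] to [P *m M *m P^T] loses
    no rank. *)
Lemma rank_moment_eq u s t (L : dual_le n R t) :
  (u <= s)%N -> (s.*2 <= t)%N ->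
  \rank (moment_mx s L) = \rank (moment_mx u L) <->
  (forall p, polys_le s p -> exists2 q, polys_le u q & radical s (mfun L) (p - q)).
Proof.
move=> us st; have ut : (u.*2 <= t)%N by apply: leq_trans st; rewrite leq_double.
have /boolp.choice[f fE] : forall i : 'I_#|{: 'X_{1..n < u.+1}}|,
    exists j : 'I_#|{: 'X_{1..n < s.+1}}|, bmon j = bmon i.
  by move=> i; apply/bmon_surj/(leq_trans (bmon_le i)).
set M := moment_mx s L; pose P : 'M[R]_(_, _) := rowsub f 1%:M.
have PME i j : (P *m M) i j = mfun L ('X_[bmon i] * 'X_[bmon j]).
  by rewrite -rowsubE mxE moment_mxE // fE.
have PM : moment_mx u L = P *m M *m P^T.
  apply: trmx_inj; rewrite trmx_mul trmxK -rowsubE.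
  apply/matrixP => i j; rewrite [RHS]mxE [RHS]mxE PME fE [LHS]mxE.
  by rewrite moment_mxE // mulrC.
have flatE : (forall p, polys_le s p ->
     exists2 q, polys_le u q & radical s (mfun L) (p - q)) <-> (M <= P *m M)%MS.
  split=> [flat|/submxP[W MW] p ps].
    apply/row_subP => i.
    have [q qu [_ qr]] := flat 'X_[bmon i] (proj2 (polys_le_X _ _ _) (bmon_le i)).
    apply/submxP; exists (\row_k q@_(bmon k)); apply/rowP => j.
    rewrite mxE moment_mxE // mxE.
    have /eqP := qr 'X_[bmon j] (proj2 (polys_le_X _ _ _) (bmon_le j)).
    rewrite mulrBl raddfB /= subr_eq0 => /eqP ->.
    rewrite -{1}(row_polyK qu) mulr_suml raddf_sum; apply: eq_bigr => k _.
    by rewrite /= -scalerAl linearZ PME.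
  pose T := [set p | exists2 q, polys_le u q & radical s (mfun L) (p - q)].
  have lu := polys_le_linear n R u; have lr := radical_linear s (mfun L).
  suff : T p by [].
  apply: (linear_set_poly _ ps) => [|m ms].
    split; first by exists 0; [case: lu | rewrite subrr; case: lr].
    move=> a v w [q qu qr] [q' q'u q'r]; exists (a *: q + q'); first exact: lu.2.
    by rewrite opprD addrACA -scalerBr; apply: lr.2.
  have [i <-] := bmon_surj ms; exists (row_poly (row i W)).
    exact: row_poly_le.
  rewrite radicalP; split=> [|m' ms'].
    apply: linear_setB; [exact: polys_le_linear|exact/polys_le_X/bmon_le|].
    exact/(polys_leW us)/row_poly_le.
  have [j <-] := bmon_surj ms'; rewrite mulrBl raddfB; apply/eqP.
  rewrite subr_eq0 /= -moment_mxE // -/M MW mxE mulr_suml linear_sum.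
  by apply/eqP/eq_bigr => k _; rewrite /= PME -scalerAl linearZ mxE.
rewrite flatE PM; have [/= PM_le PM_eq] := mxrank_leqif_sup (submxMl P M).
split=> [E|MP].
  rewrite -PM_eq eqn_leq PM_le /= E; exact: mxrankM_maxl.
have /submxP[W MW] := MP.
have -> : \rank M = \rank (P *m M) by apply/esym/eqP; rewrite PM_eq.
apply/eqP; rewrite eqn_leq mxrankM_maxl andbT.
have {1}<- : P *m M *m P^T *m W^T = P *m M.
  have MT : M^T = M by apply: trmx_moment.
  by rewrite -!mulmxA -{2}MT {2}MW !trmx_mul MT !mulmxA.
exact: mxrankM_maxl.
Qed.

Lemma radical_rank_eq s t (L L' : dual_le n R t) : (s.*2 <= t)%N ->
  radical s (mfun L') `<=` radical s (mfun L) ->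
  (\rank (moment_mx s L') <= \rank (moment_mx s L))%N ->
  radical s (mfun L) `<=` radical s (mfun L').
Proof.
move=> st sub rk.
have ker_sub : (kermx (moment_mx s L') <= kermx (moment_mx s L))%MS.
  apply/rV_subP => u /sub_kermxP/(mul_row_moment_eq0 L' st u)/sub.
  by move=> /(mul_row_moment_eq0 L st u) uL; apply/sub_kermxP.
have [/= _ le] := mxrank_leqif_sup ker_sub.
have {}le : (kermx (moment_mx s L) <= kermx (moment_mx s L'))%MS.
  rewrite -le eqn_leq mxrankS //= !mxrank_ker; exact: leq_sub2l.
move=> p pr; have ps := pr.1; rewrite -(row_polyK ps).
apply/(mul_row_moment_eq0 L' st)/sub_kermxP; apply: submx_trans le.
by apply/sub_kermxP/(mul_row_moment_eq0 L st); rewrite row_polyK.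
Qed.

End Functionals.

(** * Flat extensions *)

Section IdealSets.
Variables (n : nat) (R : realType).
Implicit Types (S T : set {mpoly R[n]}).

Definition ideal_set S : Prop :=
  [/\ S 0, forall p q, S p -> S q -> S (p + q) & forall c p, S p -> S (c * p)].

Lemma ideal_linear S : ideal_set S -> linear_set S.
Proof.
move=> [S0 SD SM]; split=> // a p q Sp Sq; apply: SD => //.
by rewrite -mul_mpolyC; apply: SM.
Qed.

Lemma ideal_gen_ideal S : ideal_set (ideal_gen S).
Proof.
split=> [|_ _ [k [c [g [Sg ->]]]] [k' [c' [g' [Sg' ->]]]]|d _ [k [c [g [Sg ->]]]]].
- by exists 0%N, (fun=> 0), (fun=> 0); rewrite big_ord0; split=> // -[].
- pose join (f : 'I_k -> {mpoly R[n]}) (f' : 'I_k' -> {mpoly R[n]}) i :=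
    match split i with inl j => f j | inr j => f' j end.
  exists (k + k')%N, (join c c'), (join g g'); split.
    by move=> i; rewrite /join; case: (split i).
  rewrite big_split_ord /=; congr (_ + _); apply: eq_bigr => i _.
    by rewrite /join (unsplitK (inl i)).
  by rewrite /join (unsplitK (inr i)).
- exists k, (fun i => d * c i : {mpoly R[n]}), g; split=> //.
  by rewrite mulr_sumr; apply: eq_bigr => i _; rewrite mulrA.
Qed.

Lemma sub_ideal_gen S : S `<=` ideal_gen S.
Proof.
move=> p Sp; exists 1%N, (fun=> 1), (fun=> p); split=> //.
by rewrite big_ord1 mul1r.
Qed.

Lemma ideal_gen_min S T : ideal_set T -> S `<=` T -> ideal_gen S `<=` T.
Proof.
move=> iT ST _ [k [c [g [Sg ->]]]]; apply: linear_set_sum => [|i _].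
  exact: ideal_linear.
by case: iT => _ _; apply; apply: ST.
Qed.

Lemma ideal_setM_l S p c : ideal_set S -> S p -> S (p * c).
Proof. by move=> [_ _ SM] Sp; rewrite mulrC; apply: SM. Qed.

Lemma ideal_setX S : linear_set S -> (forall i p, S p -> S ('X_i * p)) ->
  ideal_set S.
Proof.
move=> lS SX; split=> [|p q|c p Sp]; [by case: lS|exact: linear_setD|].
apply: (@linear_set_all n R [set c | S (c * p)] c) => [|m].
  split=> [|a u v] /=; first by rewrite mul0r; case: lS.
  by rewrite mulrDl -scalerAl; apply: lS.2.
elim/mnm_ind: m => [|i m] /=; first by rewrite mpolyX0 mul1r.
by move=> Sm; rewrite mpolyXD -mulrA; apply: SX.
Qed.

Lemma mpoly_linear_ext (V : lmodType R) (F : 'X_{1..n} -> V) :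
  exists f : {linear {mpoly R[n]} -> V}, forall m, f 'X_[m] = F m.
Proof.
pose f p := \sum_(m <- msupp p) p@_m *: F m.
have fE k p : (msize p <= k)%N -> f p = \sum_(m : 'X_{1..n < k}) p@_m *: F m.
  move=> pk; pose I : subFinType _ := 'X_{1..n < k}.
  rewrite /f (big_mksub I) //=; first last.
  - by move=> x /msize_mdeg_lt /leq_trans; apply.
  - by rewrite msupp_uniq.
  by rewrite big_rmcond //= => i; move/memN_msupp_eq0 ->; rewrite scale0r.
have f_lin : linear f.
  move=> a p q; pose k := maxn (msize p) (msize q).
  have pk : (msize p <= k)%N by rewrite leq_maxl.
  have qk : (msize q <= k)%N by rewrite leq_maxr.
  rewrite !(fE k) //; last first.
    apply: leq_trans (msizeD_le _ _) _; rewrite geq_max qk andbT.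
    exact: leq_trans (msizeZ_le _ _) pk.
  rewrite scaler_sumr -big_split; apply: eq_bigr => m _.
  by rewrite mcoeffD mcoeffZ scalerDl scalerA.
pose fL : {linear {mpoly R[n]} -> V} :=
  HB.pack f (GRing.isLinear.Build _ _ _ _ _ f_lin).
exists fL => m /=.
by rewrite /f msuppX big_seq1 mcoeffX eqxx scale1r.
Qed.

Lemma linear_reduction u s T : linear_set T ->
  (forall p, polys_le s p -> exists2 q, polys_le u q & T (p - q)) -> (u <= s)%N ->
  exists rho : {mpoly R[n]} -> {mpoly R[n]},
  [/\ forall a p q, polys_le s p -> polys_le s q ->
        rho (a *: p + q) = a *: rho p + rho q,
      forall p, polys_le s p -> polys_le u (rho p) /\ T (p - rho p) &
      forall p, polys_le s p -> T p -> rho p = 0].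
Proof.
move=> lT flat us; pose K := vle s T; pose U := vle s (@polys_le n R u).
have lu := polys_le_linear n R u; have ls := polys_le_linear n R s.
have UK x : x \in (U + K)%VS.
  have [q qu Tq] := flat _ (polys_le_mpoly_le x).
  have qs := polys_leW us qu.
  have -> : x = insubd 0 q + (x - insubd 0 q) by rewrite addrC subrK.
  apply: memv_add; first by apply/vleP; rewrite // val_insubd.
  by apply/vleP; rewrite // -[val _]/(val x - val (insubd _ q)) val_insubd.
(* [U] and [K] may intersect: [addv_pi1] projects along [K] onto a complement of [K] inside [U], so
   it vanishes on [K]. *)
pose rho p := val (addv_pi1 U K (insubd 0 p)).
have pi2K x : x - addv_pi1 U K x \in K.
  by rewrite -{1}(addv_pi1_pi2 (UK x)) addrC addKr memv_pi2.
exists rho; split=> [a p q ps qs|p ps|p ps Tp].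
- have E : insubd (0 : mpoly_le n R s) (a *: p + q) = a *: insubd 0 p + insubd 0 q.
    apply: val_inj; rewrite -[RHS]/(a *: val (insubd _ p) + val (insubd _ q)).
    by rewrite !val_insubd //; apply: ls.2.
  by rewrite /rho E !linearP.
- split.
    exact/(vleP _ lu)/memv_pi1.
  have /(vleP _ lT) := pi2K (insubd 0 p).
  by rewrite -[val _]/(val (insubd _ p) - rho p) val_insubd.
- have pK : insubd (0 : mpoly_le n R s) p \in K by apply/vleP; rewrite // val_insubd.
  have := addv_pi1_pi2 (UK (insubd 0 p)); rewrite addv_pi2_id //.
  by rewrite -[RHS]add0r => /addIr; rewrite /rho => ->; rewrite linear0.
Qed.

End IdealSets.

Section FlatExtension.
Variables (n : nat) (R : realType) (s : nat) (l : {scalar {mpoly R[n]}}).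
Implicit Types (p q : {mpoly R[n]}).
Hypothesis l_ge0 : nonneg s.+1 l.

Local Notation T := (radical s.+1 l).

Hypothesis flat : forall p, polys_le s.+1 p ->
  exists2 q, polys_le s q & T (p - q).

Let lT : linear_set T := radical_linear s.+1 l.
Let leS p : polys_le s p -> polys_le s.+1 p := polys_leW (leqnSn s).

Let leX i p : polys_le s p -> polys_le s.+1 ('X_i * p).
Proof. by move=> ps; rewrite -add1n; apply: polys_leM => //; apply: polys_le_X1. Qed.

Let T_eq a b c : T (a - b) -> polys_le s.+1 c -> l (a * c) = l (b * c).
Proof. by move=> [_ lT'] /lT'/eqP; rewrite mulrBl raddfB subr_eq0 => /eqP. Qed.

(** The test polynomial [q] of degree [s.+1] may be replaced by [q'] of degree [s]; then ['X_i]
    moves over to [q'] and the membership of [p] applies. *)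
Lemma radicalX i p : polys_le s p -> T p -> T ('X_i * p).
Proof.
move=> ps [_ lp]; split=> [|q qs]; first exact: leX.
have [q' q's qq'] := flat qs.
rewrite -[RHS](lp _ (leX i q's)) mulrC (T_eq qq' (leX i ps)).
by congr (l _); ring.
Qed.

(* rho projects R[x]_(s+1) onto R[x]_s along T; the maps b |-> rho ('X_i * b)
   commute, Phi p is p evaluated at them and applied to rho 1, and
   l' := l \o Phi. *)
Lemma flat_extension : exists l' : {scalar {mpoly R[n]}},
  [/\ forall p, polys_le s.+1.*2 p -> l' p = l p,
      forall p, 0 <= l' (p ^+ 2) &
      forall p, ideal_gen T p <-> l' (p ^+ 2) = 0].
Proof.
have [rho [rhoP rho_le rho0]] := linear_reduction lT flat (leqnSn s).
have rhoD p q : polys_le s.+1 p -> polys_le s.+1 q -> rho (p + q) = rho p + rho q.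
  by move=> ps qs; rewrite -[p]scale1r rhoP // !scale1r.
have rho_eq p q : polys_le s.+1 p -> polys_le s.+1 q -> T (p - q) -> rho p = rho q.
  move=> ps qs Tpq; have pqs := linear_setB (polys_le_linear n R _) ps qs.
  by rewrite -[p](subrK q) rhoD // (rho0 _ pqs Tpq) add0r.
pose X i p := rho ('X_i * p).
have Xs i p : polys_le s p -> polys_le s (X i p).
  by move=> ps; have [] := rho_le _ (leX i ps).
have XC i j p : polys_le s p -> X i (X j p) = X j (X i p).
  move=> ps; apply: rho_eq; try exact/leX/Xs.
  have Tk k : T ('X_k * p - X k p) by have [] := rho_le _ (leX k ps).
  split=> [|q qs].
    by apply: linear_setB; [exact: polys_le_linear|exact/leX/Xs|exact/leX/Xs].
  have [q' q's qq'] := flat qs.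
  (* Once [q] is reduced to degree [s], [X k' p] can be replaced by ['X_k' * p] in the pairing; the
     result is symmetric in [k] and [k']. *)
  have key k k' : l ('X_k * X k' p * q) = l ('X_k * 'X_k' * p * q').
    rewrite mulrC (T_eq qq' (leX k (Xs k' _ ps))).
    have -> : q' * ('X_k * X k' p) = X k' p * ('X_k * q') by ring.
    by rewrite -(T_eq (Tk k') (leX k q's)); congr (l _); ring.
  by rewrite mulrBl raddfB /= !key (mulrC 'X_i) subrr.
pose phiX (m : 'X_{1..n}) (r : seq 'I_n) :=
  foldr (fun i v => iter (m i) (X i) v) (rho 1) r.
have rho1s : polys_le s (rho 1) by have [] := rho_le _ (polys_le1 n R s.+1).
have iters k i p : polys_le s p -> polys_le s (iter k (X i) p).
  by move=> ps; elim: k => //= k; apply: Xs.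
have phiXs m r : polys_le s (phiX m r).
  by elim: r => //= i r; apply: iters.
have iterC k i j p : polys_le s p -> X i (iter k (X j) p) = iter k (X j) (X i p).
  by move=> ps; elim: k => //= k IH; rewrite XC ?IH //; apply: iters.
(* One more [X i] appears inside the nested iterates and commutes to the front. The list is
   arbitrary for the sake of the induction. *)
have phiXS i m r : uniq r ->
    phiX (U_(i) + m)%MM r = if i \in r then X i (phiX m r) else phiX m r.
  elim: r => //= j r IH /andP[jr /IH {}IH]; rewrite IH mnmDE mnm1E inE.
  case: (eqVneq i j) jr => [->|ij] jr /=; first by rewrite (negbTE jr).
  by case: ifP => // _; rewrite iterC.
have [Phi PhiE] := mpoly_linear_ext (fun m => phiX m (enum 'I_n)).
have PhiX0 : Phi 1 = rho 1.
  rewrite -[in LHS]mpolyX0 PhiE /phiX; elim: (enum _) => //= i r ->.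
  by rewrite mnm0E.
have Phi_le q : polys_le s (Phi q).
  apply: (@linear_set_all n R [set q | polys_le s (Phi q)]) => [|m] /=.
    have [l0 lD] := polys_le_linear n R s.
    by split=> [|a u v]; rewrite /= ?linear0 ?linearP //; apply: lD.
  by rewrite PhiE.
have PhiX i q : Phi ('X_i * q) = X i (Phi q).
  apply: (@linear_set_all n R [set q | Phi ('X_i * q) = X i (Phi q)]) => [|m] /=.
    split=> [|a u v] /=.
      rewrite mulr0 linear0 /X mulr0 rho0 //; last exact: lT.1.
      exact: (polys_le_linear n R _).1.
    rewrite mulrDr -scalerAr !linearP => -> ->; rewrite /X mulrDr -scalerAr.
    by rewrite rhoP //; apply/leX/Phi_le.
  by rewrite -mpolyXD !PhiE phiXS ?enum_uniq // mem_enum.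
have Trho p : polys_le s.+1 p -> T (p - rho p) by case/rho_le.
(* By induction [Phi 'X_[m]] is [rho 'X_[m]], which differs from ['X_[m]] by an element of [T];
   [radicalX] keeps this so after multiplication by ['X_i]. *)
have Phi_rho q : polys_le s.+1 q -> Phi q = rho q.
  move=> qs; apply: (@linear_set_poly n R
    [set q | polys_le s.+1 q /\ Phi q = rho q] s.+1 q _ qs _).2.
    have [l0 lD] := polys_le_linear n R s.+1.
    split=> [|a u v [us uE] [vs vE]] /=.
      by rewrite linear0 rho0 //; case: lT.
    by split; [apply: lD | rewrite linearP rhoP // uE vE].
  elim/mnm_ind => [_|i m IH]; first by rewrite mpolyX0; split=> //; apply: polys_le1.
  rewrite mdegD mdeg1 add1n ltnS => ms.
  have ms' : polys_le s ('X_[m] : {mpoly R[n]}) by apply/polys_le_X.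
  rewrite mpolyXD; split; first exact: leX.
  have [_ E] := IH (leqW ms); have [rs Tr] := rho_le _ (leS ms').
  rewrite PhiX E /X; apply: rho_eq; [exact: leX|exact: leX|].
  rewrite -mulrBr; apply: radicalX; last exact: linear_setBC.
  exact: (linear_setB (polys_le_linear n R _) rs ms').
have J_ideal := ideal_gen_ideal T.
have ker_ideal : ideal_set [set q | Phi q = 0].
  apply: ideal_setX => [|i p] /=.
    split=> [|a u v] /=; first exact: linear0.
    by rewrite linearP => -> ->; rewrite scaler0 addr0.
  rewrite PhiX => ->; rewrite /X mulr0 rho0 //; last exact: lT.1.
  exact: (polys_le_linear n R _).1.
(* Each application of [X i] differs from multiplication by ['X_i] by an element of [T]. *)
have J_red q : ideal_gen T (q - Phi q).
  have lJ := ideal_linear J_ideal.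
  apply: (@linear_set_all n R [set q | ideal_gen T (q - Phi q)]) => [|m] /=.
    split=> [|a u v] /=; first by rewrite linear0 subrr; case: lJ.
    by rewrite linearP opprD addrACA -scalerBr; apply: lJ.2.
  elim/mnm_ind: m => [|i m IH].
    rewrite mpolyX0 PhiX0; apply/sub_ideal_gen/Trho/polys_le1.
  rewrite mpolyXD PhiX; apply: (linear_set_trans lJ (v := 'X_i * Phi 'X_[m])).
    by rewrite -mulrBr; case: J_ideal => _ _; apply.
  exact/sub_ideal_gen/Trho/leX.
have J_ker q : ideal_gen T q <-> Phi q = 0.
  split; last by move=> Phi0; have := J_red q; rewrite Phi0 subr0.
  apply: (ideal_gen_min ker_ideal) => p Tp /=.
  by have ps := Tp.1; rewrite Phi_rho // rho0.
have l'_lin : scalar (fun q => l (Phi q)) by move=> a p q; rewrite !linearP.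
pose l' : {scalar {mpoly R[n]}} :=
  HB.pack (fun q => l (Phi q)) (GRing.isLinear.Build _ _ _ _ _ l'_lin).
have l'E q : l' q = l (Phi q) by [].
have l'J q : ideal_gen T q -> l' q = 0.
  by move=> /J_ker; rewrite l'E => ->; rewrite linear0.
(* The variables of [p] leave [Phi] one at a time: [rho] changes its argument by an element of [T],
   invisible to [l] against a factor of degree at most [s.+1]. *)
have mul_adj p q : polys_le s.+1 p -> l (Phi (p * q)) = l (p * Phi q).
  move=> ps; apply: (@linear_set_poly n R
    [set p | forall q, l (Phi (p * q)) = l (p * Phi q)] s.+1 p _ ps _) => {p ps q}.
    split=> [|a u v uE vE] q; first by rewrite !mul0r linear0.
    by rewrite !mulrDl -!scalerAl !linearP /= uE vE.
  elim/mnm_ind => [_ q|i m IH]; first by rewrite mpolyX0 !mul1r.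
  rewrite mdegD mdeg1 add1n ltnS => ms q.
  rewrite mpolyXD -mulrA mulrCA IH ?(leqW ms) // PhiX mulrC.
  rewrite -(T_eq (Trho _ (leX i (Phi_le q)))); last exact/leS/polys_le_X.
  by congr (l _); ring.
have l'_l p : polys_le s.+1.*2 p -> l' p = l p.
  move=> ps; apply: (@linear_set_poly n R [set p | l' p = l p] _ p _ ps _).
    by split=> [|a u v] /=; rewrite ?linear0 // !linearP => -> ->.
  move=> m; rewrite -addnn => /mnm_split[a [b [-> ha hb]]] /=.
  have as_ : polys_le s.+1 ('X_[a] : {mpoly R[n]}) by apply/polys_le_X.
  have bs : polys_le s.+1 ('X_[b] : {mpoly R[n]}) by apply/polys_le_X.
  rewrite mpolyXD mul_adj // Phi_rho // mulrC -(T_eq (Trho _ bs)) //.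
  by rewrite mulrC.
(* The defect [q ^+ 2 - Phi q ^+ 2] is a multiple of [q - Phi q], hence in the ideal of [T].
   Positivity and the null space of [l'] are thus read off in degree at most [s]. *)
have l'_sqr q : l' (q ^+ 2) = l (Phi q ^+ 2).
  have J2 : ideal_gen T (q ^+ 2 - Phi q ^+ 2).
    by rewrite subr_sqr mulrC; case: J_ideal => _ _; apply.
  have -> : l' (q ^+ 2) = l' (q ^+ 2 - Phi q ^+ 2) + l' (Phi q ^+ 2).
    by rewrite -linearD subrK.
  rewrite (l'J _ J2) add0r l'_l //.
  exact/polys_le_sqr/leS.
exists l'; split=> [//|q|q]; first by rewrite l'_sqr; apply/l_ge0/leS.
split=> [/J_ker Phi0|]; first by rewrite l'_sqr Phi0 expr0n linear0.
rewrite l'_sqr => /(radical_sqr l_ge0 (leS (Phi_le q)))/sub_ideal_gen PhiJ.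
rewrite -[q](subrK (Phi q)); case: J_ideal => _ JD _; exact: JD.
Qed.

End FlatExtension.

(** * Real radicals *)

Section RealRadical.
Variables (n : nat) (R : realType).
Implicit Types (p q x y : {mpoly R[n]}) (I : set {mpoly R[n]}).

Definition sos : set {mpoly R[n]} :=
  [set p | exists k (q : 'I_k -> {mpoly R[n]}), p = \sum_j q j ^+ 2].

Definition real_set I : Prop := forall k (q : 'I_k -> {mpoly R[n]}),
  I (\sum_j q j ^+ 2) -> forall i, I (q i).

Lemma sos_sqr p : sos (p ^+ 2).
Proof. by exists 1%N, (fun=> p); rewrite big_ord1. Qed.

Lemma sosD p q : sos p -> sos q -> sos (p + q).
Proof.
move=> [k [f ->]] [k' [f' ->]].
exists (k + k')%N, (fun i => match split i with inl j => f j | inr j => f' j end).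
rewrite big_split_ord /=; congr (_ + _); apply: eq_bigr => i _.
  by rewrite (unsplitK (inl i)).
by rewrite (unsplitK (inr i)).
Qed.

Lemma sos0 : sos 0.
Proof. by exists 0%N, (fun=> 0); rewrite big_ord0. Qed.

Lemma sos_sum J (r : seq J) (F : J -> {mpoly R[n]}) :
  (forall i, sos (F i)) -> sos (\sum_(i <- r) F i).
Proof. by move=> sF; elim/big_ind: _ => //; [apply: sos0 | apply: sosD]. Qed.

Lemma sosM p q : sos p -> sos q -> sos (p * q).
Proof.
move=> [k [f ->]] [k' [f' ->]]; rewrite mulr_suml; apply: sos_sum => i.
by rewrite mulr_sumr; apply: sos_sum => j; rewrite -exprMn; apply: sos_sqr.
Qed.

Lemma sos1 : sos 1.
Proof. by rewrite -[1](expr1n _ 2); apply: sos_sqr. Qed.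

Lemma sosX p m : sos p -> sos (p ^+ m).
Proof.
by move=> sp; elim: m => [|m IH]; rewrite ?exprS; [apply: sos1 | apply: sosM].
Qed.

(** Monotonicity of powers for the order given by sums of squares; it carries estimates between
    squares to the powers occurring in the real radical. *)
Lemma sos_leX x y m : sos x -> sos (y - x) -> sos (y ^+ m - x ^+ m).
Proof.
move=> sx sxy; have sy : sos y by rewrite -[y](subrK x); apply: sosD.
elim: m => [|m IH]; first by rewrite subrr; apply: sos0.
have -> : y ^+ m.+1 - x ^+ m.+1 = y * (y ^+ m - x ^+ m) + (y - x) * x ^+ m.
  by rewrite !exprS; ring.
by apply: sosD; apply: sosM => //; apply: sosX.
Qed.

Lemma sos_sub_sum k (q : 'I_k -> {mpoly R[n]}) i :
  sos (\sum_j q j ^+ 2 - q i ^+ 2).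
Proof.
rewrite (bigD1 i) //= addrAC subrr add0r big_mkcond; apply: sos_sum => j.
by case: ifP => _; [apply: sos_sqr | apply: sos0].
Qed.

Section Ideal.
Variable I : set {mpoly R[n]}.
Hypothesis idI : ideal_set I.

(** In the preorder where [x <= y] means that [y - x] is a sum of squares modulo [I], these are the
    [p <= 0]. *)
Definition neg_sos : set {mpoly R[n]} :=
  [set p | exists2 q, sos q & I (p + q)].

Lemma neg_sosD p q : neg_sos p -> neg_sos q -> neg_sos (p + q).
Proof.
move=> [a sa Ia] [b sb Ib]; exists (a + b); first exact: sosD.
by rewrite addrACA; case: idI => _ ID _; apply: ID.
Qed.

Lemma neg_sos0 : neg_sos 0.
Proof. by exists 0; [apply: sos0 | rewrite addr0; case: idI]. Qed.

Lemma neg_sosM p q : sos p -> neg_sos q -> neg_sos (p * q).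
Proof.
move=> sp [a sa Ia]; exists (p * a); first exact: sosM.
by rewrite -mulrDr; case: idI => _ _; apply.
Qed.

Lemma neg_sos_le p q : sos (q - p) -> neg_sos q -> neg_sos p.
Proof.
move=> sqp [a sa Ia]; exists (q - p + a); first exact: sosD.
by rewrite addrA addrCA subrr addr0.
Qed.

Lemma real_radicalE p :
  real_radical I p <-> exists2 k, (0 < k)%N & neg_sos ((p ^+ 2) ^+ k).
Proof.
split=> [[k [r [q [k0 Iq]]]]|[k k0 [_ [r [q ->]] Iq]]].
  by exists k => //; exists (\sum_j q j ^+ 2); [exists r, q|rewrite -exprM mul2n].
by exists k, r, q; split=> //; rewrite -mul2n exprM.
Qed.

(** For a sum, [(p + q) ^+ 2] is at most [u + v] with [u] and [v] twice the squares of [p] and [q],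
    and every term of the binomial expansion of [(u + v) ^+ (k + l)] contains [u ^+ k] or
    [v ^+ l]. *)
Lemma real_radical_ideal : ideal_set (real_radical I).
Proof.
split.
- by apply/real_radicalE; exists 1%N => //; rewrite expr1 expr0n; apply: neg_sos0.
- move=> p q /real_radicalE[k k0 kp] /real_radicalE[l l0 lq].
  apply/real_radicalE; exists (k + l)%N; first by rewrite addn_gt0 k0.
  pose u := p ^+ 2 + p ^+ 2; pose v := q ^+ 2 + q ^+ 2.
  have su : sos u by apply: sosD; apply: sos_sqr.
  have sv : sos v by apply: sosD; apply: sos_sqr.
  have s2 : sos (1 + 1) by apply: sosD; apply: sos1.
  have ku : neg_sos (u ^+ k).
    have -> : u = (1 + 1) * p ^+ 2 by rewrite /u; ring.
    by rewrite exprMn; apply: neg_sosM => //; apply: sosX.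
  have lv : neg_sos (v ^+ l).
    have -> : v = (1 + 1) * q ^+ 2 by rewrite /v; ring.
    by rewrite exprMn; apply: neg_sosM => //; apply: sosX.
  apply: (@neg_sos_le _ ((u + v) ^+ (k + l))).
    apply: sos_leX; first exact: sos_sqr.
    have -> : u + v - (p + q) ^+ 2 = (p - q) ^+ 2 by rewrite /u /v; ring.
    exact: sos_sqr.
  rewrite exprDn; elim/big_ind: _ => [||[i ?] _ /=]; [exact: neg_sos0|exact: neg_sosD|].
  suff term : neg_sos (u ^+ (k + l - i) * v ^+ i).
    elim: ('C(_, _)) => [|m IH]; first by rewrite mulr0n; apply: neg_sos0.
    by rewrite mulrS; apply: neg_sosD.
  have [li|il] := leqP l i.
    rewrite -(subnK li) exprD mulrA; apply: neg_sosM => //.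
    by apply: sosM; apply: sosX.
  have -> : (k + l - i = l - i + k)%N by rewrite addnC addnBAC // ltnW.
  rewrite exprD mulrAC; apply: neg_sosM => //.
  by apply: sosM; apply: sosX.
- move=> c p /real_radicalE[k k0 kp]; apply/real_radicalE; exists k => //.
  rewrite -exprM exprMn !exprM; apply: neg_sosM => //; exact/sosX/sos_sqr.
Qed.

(** Each [q i ^+ 2] is at most the whole sum in the order of [sos], and powers preserve this. *)
Lemma real_radical_real : real_set (real_radical I).
Proof.
move=> r q /real_radicalE[k k0 kq] i.
apply/real_radicalE; exists (2 * k)%N; first by rewrite muln_gt0.
move: kq; rewrite -exprM; apply: neg_sos_le; apply: sos_leX; first exact: sos_sqr.
exact: sos_sub_sum.
Qed.

Lemma sub_real_radical : I `<=` real_radical I.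
Proof.
move=> p Ip; apply/real_radicalE; exists 1%N => //; exists 0; first exact: sos0.
by rewrite addr0 expr1 expr2; case: idI => _ _; apply.
Qed.

Lemma real_radical_vanishing :
  real_radical I `<=` vanishing_ideal (real_variety I).
Proof.
move=> p [k [r [q [k0 Iq]]]] v /(_ _ Iq).
rewrite mevalD raddf_sum /= => /eqP; rewrite paddr_eq0.
- by move=> /andP[]; rewrite rmorphXn expf_eq0 => /andP[_ /eqP].
- by rewrite rmorphXn -mul2n exprM exprn_ge0 ?sqr_ge0.
- by apply: sumr_ge0 => j _; rewrite rmorphXn sqr_ge0.
Qed.

End Ideal.

Lemma real_radicalS I I' : I `<=` I' -> real_radical I `<=` real_radical I'.
Proof. by move=> II' p [k [r [q [k0 /II' Iq]]]]; exists k, r, q. Qed.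

Lemma pos_vanish (l : {scalar {mpoly R[n]}}) p :
  (forall p, 0 <= l (p ^+ 2)) -> l (p ^+ 2) = 0 -> l p = 0.
Proof.
move=> l0 lp; have l0' : nonneg (msize p) l by move=> q _; apply: l0.
have [_ /(_ 1 (polys_le1 _ _ _))] := (radical_sqr l0' (polys_le_msize p)).2 lp.
by rewrite mulr1.
Qed.

(** Both [p ^+ k.*2] and the sum of squares have nonnegative value under [l], so membership of their
    sum in [J] forces [l (p ^+ k.*2) = 0], that is, [p ^+ k] in [J]. *)
Lemma is_real_radical_pos J (l : {scalar {mpoly R[n]}}) : ideal_set J ->
  (forall p, 0 <= l (p ^+ 2)) -> (forall p, J p <-> l (p ^+ 2) = 0) ->
  is_real_radical J.
Proof.
move=> idJ l0 Jl; apply/seteqP; split; first exact: sub_real_radical.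
have lJ p : J p -> l p = 0 by move=> /Jl; apply: pos_vanish.
move=> p [k [r [q [k0 /lJ]]]]; rewrite linearD linear_sum /= => /eqP.
have pk0 : 0 <= l (p ^+ k.*2) by rewrite -muln2 exprM.
rewrite paddr_eq0 //; last by apply: sumr_ge0 => j _; apply: l0.
move=> /andP[/eqP lk _]; have {lk} : J (p ^+ k) by apply/Jl; rewrite -exprM muln2.
(* Lowering the exponent: the square of [p ^+ k.+1] is a multiple of [p ^+ k.+2]. *)
elim: k k0 {pk0} => // -[|k] IH _ Jk; first by rewrite expr1 in Jk.
apply: IH => //; apply/Jl/lJ.
have -> : (p ^+ k.+1) ^+ 2 = p ^+ k * p ^+ k.+2.
  by rewrite -exprM -exprD muln2 -addnn !addnS addSn.
by case: idJ => _ _; apply.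
Qed.

End RealRadical.

(** * Functionals positive on squares outside a real ideal *)

Section Genericity.
Variables (n : nat) (R : realType).
Implicit Types (p q : {mpoly R[n]}).

(* As P is real, the sums of squares of a complement of P in R[x]_r vanish in
   R[x]_t / P only trivially, so strict_separation applies there. *)
Lemma positive_functional t r (P : set {mpoly R[n]}) : (r.*2 <= t)%N ->
  ideal_set P -> real_set P ->
  exists L : dual_le n R t,
    (forall p, polys_le t p -> P p -> mfun L p = 0) /\
    (forall p, polys_le r p -> ~ P p -> 0 < mfun L (p ^+ 2)).
Proof.
move=> rt idP reP; have lP := ideal_linear idP.
pose Pt := vle t P; pose W := ((vle r P)^C)%VS.
pose X := vbasis {: mpoly_le n R t}.
(* Coordinates modulo P: subtracting the projection onto [Pt] makes P the kernel of [e]. *)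
pose e (x : mpoly_le n R t) := \row_i coord X i (x - projv Pt x).
have e_lin : linear e.
  move=> a x y; apply/rowP => i; rewrite !mxE -linearP; congr (coord X i _).
  by rewrite linearP opprD addrACA -scalerBr.
have e0 x : e x = 0 <-> P (val x).
  rewrite -(vleP x lP) -/Pt; split=> [ex0|xP]; last first.
    by apply/rowP => i; rewrite !mxE projv_id // subrr linear0.
  suff /eqP : x - projv Pt x = 0 by rewrite subr_eq0 => /eqP ->; apply: memv_proj.
  rewrite (coord_vbasis (memvf (x - projv Pt x))) big1 // => i _.
  by have := congr1 (fun v : 'rV__ => v 0 i) ex0; rewrite !mxE => ->; rewrite scale0r.
pose eL : {linear mpoly_le n R t -> 'rV[R]_(\dim {: mpoly_le n R t})} :=
  HB.pack e (GRing.isLinear.Build _ _ _ _ _ e_lin).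
pose N := \dim W; pose b (i : 'I_N) : mpoly_le n R r := (vbasis W)`_i.
pose c p : mpoly_le n R t := insubd 0 p.
have cE p q a : polys_le t p -> polys_le t q -> c (a *: p + q) = a *: c p + c q.
  move=> pt qt; apply: val_inj; rewrite -[RHS]/(a *: val (c p) + val (c q)).
  by rewrite !val_insubd //; apply: (polys_le_linear n R t).2.
have le_mul (x y : mpoly_le n R r) : polys_le t (val x * val y).
  apply: polys_leW rt _; rewrite -addnn; apply: polys_leM; exact: polys_le_mpoly_le.
(* Structure constants of multiplication from [W] to R[x]_t modulo P, so that [quad a v v] is the
   class of a square. *)
pose a i j := e (c (val (b i) * val (b j))).
have ec_sum I (s : seq I) (d : I -> R) (f : I -> {mpoly R[n]}) :
    (forall i, polys_le t (f i)) ->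
    e (c (\sum_(i <- s) d i *: f i)) = \sum_(i <- s) d i *: e (c (f i)).
  move=> ft; elim: s => [|i s IH].
    rewrite !big_nil; apply/e0; rewrite val_insubd; first by case: lP.
    exact: (polys_le_linear n R t).1.
  rewrite !big_cons cE // ?e_lin ?IH //.
  apply: linear_set_sum => [|j _]; first exact: polys_le_linear.
  by apply: linear_setZ; first exact: polys_le_linear.
pose w (v : 'rV[R]_N) : mpoly_le n R r := \sum_i v 0 i *: b i.
have w0 v : P (val (w v)) -> v = 0.
  move=> /(vleP _ lP) vP.
  have vW : w v \in W.
    by apply: memv_suml => i _; apply/memvZ/vbasis_mem/mem_nth; rewrite size_tuple.
  have : w v \in (vle r P :&: W)%VS by rewrite memv_cap vP vW.
  rewrite capv_compl memv0 => /eqP wv0; apply/rowP => i; rewrite mxE.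
  have /freeP fr := basis_free (vbasisP W).
  exact: (fr (fun i => v 0 i) wv0 i).
have quadE v : Separation.quad a v v = e (c (val (w v) ^+ 2)).
  have -> : val (w v) ^+ 2 =
      \sum_i v 0 i *: \sum_j v 0 j *: (val (b i) * val (b j)).
    have -> : val (w v) = \sum_i v 0 i *: val (b i).
      by rewrite linear_sum; apply: eq_bigr.
    rewrite expr2 mulr_suml; apply: eq_bigr => i _.
    rewrite -scalerAl mulr_sumr; congr (_ *: _).
    by apply: eq_bigr => j _; rewrite scalerAr.
  have le_in i : polys_le t (\sum_j v 0 j *: (val (b i) * val (b j))).
    apply: linear_set_sum => [|j _]; first exact: polys_le_linear.
    by apply: linear_setZ; first exact: polys_le_linear.
  rewrite ec_sum //; apply: eq_bigr => i _; rewrite ec_sum // scaler_sumr.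
  by apply: eq_bigr => j _; rewrite scalerA.
have [B gramB|z zpos] := @Separation.strict_separation R N _ a.
  have : P (\sum_k val (w (row k B)) ^+ 2).
    have sqt k : polys_le t (val (w (row k B)) ^+ 2) by rewrite expr2.
    have <- : val (c (\sum_k val (w (row k B)) ^+ 2)) = \sum_k val (w (row k B)) ^+ 2.
      rewrite val_insubd //; apply: linear_set_sum => //; exact: polys_le_linear.
    apply/e0; rewrite -[RHS]gramB /Separation.gram.
    transitivity (e (c (\sum_k (1 : R) *: val (w (row k B)) ^+ 2))).
      by congr (e (c _)); apply: eq_bigr => k _; rewrite scale1r.
    by rewrite ec_sum //; apply: eq_bigr => k _; rewrite scale1r quadE.
  (* Reality puts every root in P; the roots lie in the complement [W], so they are 0. *)
  move=> /reP Pw; apply/row_matrixP => k; rewrite row0; exact/w0/Pw.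
pose L := linfun (fun x : mpoly_le n R t => (e x *m z) 0 0 : R^o).
have LE x : L x = (e x *m z) 0 0.
  pose g (x : mpoly_le n R t) : R^o := (e x *m z) 0 0.
  have g_lin : linear g by move=> d u v; rewrite /g e_lin mulmxDl -scalemxAl !mxE.
  pose gL : {linear mpoly_le n R t -> R^o} :=
    HB.pack g (GRing.isLinear.Build _ _ _ _ _ g_lin).
  by rewrite /L -[X in linfun X]/(gL : _ -> _) lfunE.
have L0 p : polys_le t p -> P p -> mfun L p = 0.
  move=> pt Pp; rewrite -mfunE // /leval LE.
  by have -> : e (insubd 0 p) = 0; [apply/e0; rewrite val_insubd | rewrite mul0mx mxE].
exists L; split=> // p pr Pp.
have [u [v [uW vP pE]]] : exists u v : mpoly_le n R r,
    [/\ u \in W, P (val v) & p = val u + val v].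
  have : insubd (0 : mpoly_le n R r) p \in (vle r P + W)%VS.
    by rewrite addv_complf memvf.
  move=> /memv_addP[v /(vleP _ lP) vP [u uW /(congr1 val)]].
  by rewrite val_insubd // => ->; exists u, v; split=> //; rewrite addrC.
have uE : u = w (\row_i coord (vbasis W) i u).
  by rewrite {1}(coord_vbasis uW); apply: eq_bigr => i _; rewrite mxE.
set x := \row_i coord _ i u in uE.
have x0 : x != 0.
  apply/eqP => x0; apply: Pp; rewrite pE uE x0 /w.
  rewrite big1 ?linear0 ?add0r // => i _; by rewrite mxE scale0r.
(* Modulo P, [p ^+ 2] is the square of the component [u] of [p] in [W]. *)
have -> : p ^+ 2 = val u ^+ 2 + val v * (val v + val u + val u) by rewrite pE; ring.
have ut := le_mul u u.
have vt : polys_le t (val v * (val v + val u + val u)).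
  exact: (le_mul v (v + u + u)).
rewrite linearD /= [X in _ + X]L0 //; last exact: ideal_setM_l.
by rewrite addr0 expr2 -mfunE // /leval LE -expr2 -[insubd _ _]/(c _) uE -quadE zpos.
Qed.

End Genericity.

(** * Generic elements *)

Section GenericElements.
Variables (n m : nat) (R : realType) (h : 'I_m -> {mpoly R[n]}) (t : nat).
Implicit Types (p q : {mpoly R[n]}) (L : dual_le n R t).

Local Notation r := t./2.
Local Notation I := (ideal_gen (range h)).

Lemma half_le : (r.*2 <= t)%N.
Proof. by rewrite -{2}(odd_double_half t) leq_addl. Qed.

Lemma Hset_le : Hset h t `<=` polys_le t.
Proof.
move=> _ [a [j [aj ->]]]; apply: (polys_leW aj); apply: polys_leM.
  exact/polys_le_X.
by rewrite /polys_le /= /tdeg; case: (msize _).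
Qed.

Lemma Hset_ideal : Hset h t `<=` I.
Proof.
move=> _ [a [j [_ ->]]]; case: (ideal_gen_ideal (range h)) => _ _; apply.
by apply: sub_ideal_gen; exists j.
Qed.

Lemma mfun_Hset L p : Kset h t L -> Hset h t p -> mfun L p = 0.
Proof.
move=> [LH _] hp; rewrite -mfunE; last exact: Hset_le.
apply: LH; rewrite -[mpoly_of_le _]/(val _) val_insubd //; exact: Hset_le.
Qed.

Lemma Kset_nonneg L : Kset h t L -> nonneg r (mfun L).
Proof. by move=> [_ /psd_momentE]; apply; apply: half_le. Qed.

Lemma KsetP L : (forall p, Hset h t p -> mfun L p = 0) ->
  nonneg r (mfun L) -> Kset h t L.
Proof.
move=> LH L0; split; last by apply/psd_momentE => //; apply: half_le.
move=> x hx; rewrite -leval_val mfunE ?LH //; exact: polys_le_mpoly_le.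
Qed.

Lemma mfun_trunc (l : {scalar {mpoly R[n]}}) p :
  polys_le t p -> mfun (trunc t l) p = l p.
Proof. by move=> pt; rewrite -mfunE // leval_trunc. Qed.

Lemma mfunD L L' p : mfun (L + L') p = mfun L p + mfun L' p.
Proof.
rewrite -big_split; apply: eq_bigr => k _.
by rewrite /= -mulrDr; rewrite /leval add_lfunE.
Qed.

(** [L + L'] is in K_t, and the kernel of a sum of nonnegative forms is the intersection of their
    kernels. As the rank of [L] is maximal, [L] already has that kernel. *)
Lemma generic_radical L L' : generic h L -> Kset h t L' ->
  radical r (mfun L) `<=` radical r (mfun L').
Proof.
move=> [KL Lmax] KL'; have KS : Kset h t (L + L').
  apply: KsetP => [p hp|p pr]; rewrite mfunD.
    by rewrite !mfun_Hset ?addr0.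
  by rewrite addr_ge0 ?Kset_nonneg.
have sub_radical p : radical r (mfun (L + L')) p ->
    radical r (mfun L) p /\ radical r (mfun L') p.
  move=> prad; have pr := prad.1; move: prad.
  rewrite (radical_sqr (Kset_nonneg KS) pr) /= mfunD => /eqP.
  rewrite paddr_eq0 ?(Kset_nonneg _ pr) // => /andP[/eqP p0 /eqP p0'].
  by split; apply/radical_sqr => //; apply: Kset_nonneg.
move=> p /(radical_rank_eq half_le _ (Lmax _ KS)) prad.
by apply: (sub_radical p _).2; apply: prad => q /sub_radical[].
Qed.

Lemma generic_real_radical L : generic h L ->
  radical r (mfun L) `<=` real_radical I.
Proof.
move=> gL; have idI := ideal_gen_ideal (range h).
have idP := real_radical_ideal idI.
have [L' [L'0 L'pos]] := positive_functional half_le idP (@real_radical_real _ _ I).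
have KL' : Kset h t L'.
  apply: KsetP => [p hp|p pr].
    apply: L'0; first exact: Hset_le.
    exact/(sub_real_radical idI)/Hset_ideal.
  have [Pp|Pp] := EM (real_radical I p); last exact/ltW/L'pos.
  rewrite L'0 //; first exact/(polys_leW half_le)/polys_le_sqr.
  by rewrite expr2; apply: ideal_setM_l.
move=> p /(generic_radical gL KL')/[dup] -[pr _].
move=> /(radical_sqr (Kset_nonneg KL') pr) p0.
by have [//|/(L'pos _ pr)] := EM (real_radical I p); rewrite p0 ltxx.
Qed.

Section Span.
Variable L : dual_le n R t.
Local Notation G := (Gset h L).

Lemma WsetE p : Wset L p <-> exists a g,
  [/\ (mdeg a <= r)%N, radical r (mfun L) g & p = 'X_[a] * g].
Proof.
by split=> -[a [g [ar gr ->]]]; exists a, g; split=> //;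
  rewrite ?(ker_momentE _ half_le) // -(ker_momentE _ half_le).
Qed.

Lemma Gset_le : G `<=` polys_le t.
Proof.
move=> p [/Hset_le //|/WsetE[a [g [ar [gr _] ->]]]].
apply: (polys_leW half_le); rewrite -addnn; apply: polys_leM => //.
exact/polys_le_X.
Qed.

Lemma mfun_span p : Kset h t L -> lin_span G p -> mfun L p = 0.
Proof.
move=> KL Gp; apply: (lin_span_min (T := [set p | mfun L p = 0]) _ _ Gp).
  split=> [|a u v] /=; first by rewrite linear0.
  by rewrite linearP /= => -> ->; rewrite mulr0 addr0.
move=> q [hq|/WsetE[a [g [ar [gr g0] ->]]]] /=.
  exact: (mfun_Hset KL).
by rewrite mulrC g0 //; apply/polys_le_X.
Qed.

Lemma span_mul_radical a g : (mdeg a <= r)%N -> radical r (mfun L) g ->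
  lin_span G ('X_[a] * g).
Proof.
by move=> ar gr; apply: sub_lin_span; right; apply/WsetE; exists a, g.
Qed.

End Span.

End GenericElements.

(** * Codimensions of nested linear sets *)

Section Codim.
Variables (n : nat) (R : realType).
Implicit Types S : set {mpoly R[n]}.

Lemma codim_sub u S S' : linear_set S -> linear_set S' -> S `<=` S' ->
  codim u S = codim u S' <-> (forall p, polys_le u p -> S' p -> S p).
Proof.
move=> lS lS' SS'.
have sub : (vle u S <= vle u S')%VS.
  by apply/subvP => x /(vleP _ lS)/SS'/(vleP _ lS').
split=> [E p pu S'p|sub'].
  have /eqP E' : vle u S == vle u S'.
    by rewrite eqEdim sub -(leq_add2l (codim u S)) {1}E !codim_le_add leqnn.
  have : insubd (0 : mpoly_le n R u) p \in vle u S'.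
    by apply/vleP; rewrite ?val_insubd.
  by rewrite -E' => /(vleP _ lS); rewrite val_insubd.
congr (_ - \dim _)%N; apply/vspaceP => x; apply/idP/idP; first exact: subvP.
by move=> /(vleP _ lS') S'x; apply/vleP => //; apply: sub' => //; apply: polys_le_mpoly_le.
Qed.

Lemma codim_eq0 u S : linear_set S ->
  codim u S = 0%N <-> (forall p, polys_le u p -> S p).
Proof.
move=> lS; have lT : linear_set [set: {mpoly R[n]}] by [].
have codimT : codim u [set: {mpoly R[n]}] = 0%N.
  rewrite /codim (_ : vle u setT = fullv) ?subnn //.
  by apply/vspaceP => x; rewrite memvf; apply/vleP.
rewrite -codimT codim_sub //; split=> SP p pu => [|_]; exact: SP.
Qed.

End Codim.

(** * Border bases *)

Section BorderBases.
Variables (n : nat) (R : realType) (u : nat) (G : set {mpoly R[n]}).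
Implicit Types (p q : {mpoly R[n]}) (B : set {mpoly R[n]}).
Hypothesis u_gt0 : (0 < u)%N.
Hypothesis spanX : forall i p,
  lin_span G p -> polys_le u ('X_i * p) -> lin_span G ('X_i * p).

Local Notation K := (span_le u G).

Let lG : linear_set (lin_span G) := @lin_span_linear _ _ G.
Let lu : linear_set (@polys_le n R u) := polys_le_linear n R u.
Let lK : linear_set K := linear_setI lu lG.

Lemma spanXm a p e : lin_span G p -> polys_le e p ->
  (mdeg a + e <= u)%N -> lin_span G ('X_[a] * p).
Proof.
move=> Gp pe; elim/mnm_ind: a => [_|i a IH]; first by rewrite mpolyX0 mul1r.
rewrite mdegD mdeg1 -addnA add1n => ha; rewrite mpolyXD -mulrA; apply: spanX.
  exact/IH/ltnW.
apply: polys_leW ha _; rewrite -add1n; apply: polys_leM; first exact: polys_le_X1.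
by apply: polys_leM => //; apply/polys_le_X.
Qed.

Definition standard (a : 'X_{1..n}) : Prop :=
  (mdeg a <= u)%N /\ forall p, K p -> p != 0 -> mlead p != a.

(** If [a] leads some [p] in K, then [(a + b)%MM] leads ['X_[b] * p]. The order is graded, so [p]
    has degree [mdeg a] and the product stays within degree [u]. *)
Lemma standard_factor a b : standard (a + b)%MM -> standard a.
Proof.
move=> [hab std]; rewrite mdegD in hab; split.
  by apply: leq_trans hab; rewrite leq_addr.
move=> p [pu Gp] p0; apply/eqP => pa.
have pe : polys_le (mdeg a) p by rewrite /polys_le /= -mlead_deg // pa.
have Xb0 : ('X_[b] : {mpoly R[n]}) != 0 by rewrite -msize_poly_eq0 msizeX.
have /std : K ('X_[b] * p).
  split; last by apply: spanXm Gp pe _; rewrite addnC.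
  apply: polys_leW hab _; rewrite addnC; apply: polys_leM => //.
  exact/polys_le_X.
by rewrite mulf_neq0 // mleadM // mleadXm pa addmC eqxx => /(_ isT).
Qed.

Lemma mnm_word (a : 'X_{1..n}) :
  exists w : seq 'I_n, a = (\sum_(i <- w) U_(i))%MM.
Proof.
elim/mnm_ind: a => [|i a [w ->]]; first by exists [::]; rewrite big_nil.
by exists (i :: w); rewrite big_cons.
Qed.

Lemma direct_sumP (B : set {mpoly R[n]}) p :
  direct_sum (polys_le u) (lin_span B) K -> polys_le u p ->
  exists2 q, lin_span B q & K (p - q).
Proof.
move=> [E _]; rewrite E => -[a Ba [b Kb <-]].
by exists a => //; rewrite addrC addKr.
Qed.

Lemma proj_alongP B p : direct_sum (polys_le u) (lin_span B) K ->
  polys_le u p -> lin_span B (proj_along (lin_span B) K p) /\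
  K (p - proj_along (lin_span B) K p).
Proof.
move=> dsB /(direct_sumP dsB)[q Bq Kq]; rewrite /proj_along.
by case: xgetP => [a _ [] //|/(_ q)[]].
Qed.

(* The standard monomials of span_le u G for the graded order: by spanX they
   are closed under taking factors. *)
Lemma exists_admissible_basis s : (s < u)%N ->
  (forall p, polys_le u p -> exists2 q, polys_le s q & lin_span G (p - q)) ->
  exists B, admissible_basis u G B.
Proof.
(* A monomial of degree [u] is congruent to some [q] of degree at most [s < u], so it leads an
   element of K and is not standard. *)
move=> su red; have std_le a : standard a -> (mdeg a <= u.-1)%N.
  move=> [ha std]; rewrite -ltnS prednK //.
  have [//|ua] := ltnP (mdeg a) u.
  have pu : polys_le u ('X_[a] : {mpoly R[n]}) by apply/polys_le_X.
  have [q qs Gq] := red _ pu.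
  have qa b : (s < mdeg b)%N -> q@_b = 0.
    by move=> sb; apply/memN_msupp_eq0/msize_mdeg_ge/(leq_trans qs).
  pose k := 'X_[a] - q.
  have ka : k@_a = 1.
    by rewrite mcoeffB mcoeffX eqxx qa ?subr0 //; apply: leq_trans ua.
  have k0 : k != 0.
    apply/eqP => k0; move: ka; rewrite k0 mcoeff0 => /eqP.
    by rewrite eq_sym oner_eq0.
  have Kk : K k by split=> //; apply: linear_setB => //; apply: polys_leW qs; apply: ltnW.
  have /negP[] := std _ Kk k0.
  have [//|ne] := eqVneq (mlead k) a.
  have a_le : (a <= mlead k)%O by apply: msupp_le_mlead; rewrite mcoeff_msupp ka oner_eq0.
  have := mlead_supp k0; rewrite mcoeff_msupp mcoeffB mcoeffX (eq_sym a) (negbTE ne).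
  rewrite sub0r oppr_eq0 => qk; have := lemc_mdeg a_le.
  by move=> /(leq_trans ua)/(leq_trans su)/qa/eqP; rewrite (negbTE qk).
pose B := [set ('X_[a] : {mpoly R[n]}) | a in [set a | standard a]].
have lB : linear_set (lin_span B) := @lin_span_linear _ _ B.
exists B; split.
- by move=> _ [a sa <-]; exists a => //; apply: std_le.
- move=> _ [a sa <-]; have [w aE] := mnm_word a.
  exists w; first by rewrite aE mprodXE.
  move=> k _; exists (\sum_(i <- take k w) U_(i))%MM; last by rewrite mprodXE.
  apply: (standard_factor (b := (\sum_(i <- drop k w) U_(i))%MM)).
  by rewrite -big_cat cat_take_drop -aE.
- split; last first.
    apply/seteqP; split=> [p [Bp Kp]|_ ->]; last by split; [exact: lB.1|exact: lK.1].
    apply/eqP/negP => /negP p0.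
    (* Every monomial of an element of Span B is standard, whereas the leading monomial of a nonzero
       element of K is not. *)
    have Bsupp : lin_span B `<=` [set q | forall a, q@_a != 0 -> standard a].
      apply: lin_span_min => [|_ [a sa <-] b].
        split=> [b|c v w vs ws b] /=; first by rewrite mcoeff0 eqxx.
        rewrite mcoeffD mcoeffZ; have [v0|/vs //] := eqVneq v@_b 0.
        by rewrite v0 mulr0 add0r; apply: ws.
      by rewrite mcoeffX; have [<-|_] := eqVneq a b; rewrite ?eqxx.
    have /(_ p Bp _) := Bsupp; have := mlead_supp p0; rewrite mcoeff_msupp.
    by move=> /[swap]/(_ _)/[apply] -[_ /(_ _ Kp p0)]; rewrite eqxx.
  apply/seteqP; split=> [p pu|_ [a Ba [b Kb <-]]]; last first.
    apply: linear_setD => //; last exact: Kb.1.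
    apply: (lin_span_min lu _ Ba) => _ [c [hc _] <-]; exact/polys_le_X.
  suff : [set p | exists2 a, lin_span B a & K (p - a)] p.
    by move=> [a Ba Kb]; exists a => //; exists (p - a); rewrite // addrC subrK.
  apply: (linear_set_poly _ pu).
    split=> [|c v w [a Ba Ka] [b Bb Kb]].
      by exists 0; rewrite ?subrr; [exact: lB.1|exact: lK.1].
    exists (c *: a + b); first exact: lB.2.
    by rewrite opprD addrACA -scalerBr; apply: lK.2.
  (* Division along the monomial order: a nonstandard [a] leads some [k] in K, and subtracting a
     multiple of [k] leaves smaller monomials, of no larger degree. *)
  elim/(@ltmwf n) => a IH au.
  have [sa|nsa] := EM (standard a).
    exists 'X_[a]; first by apply: sub_lin_span; exists a.
    by rewrite subrr; exact: lK.1.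
  have [k [Kk k0 ka]] : exists k, [/\ K k, k != 0 & mlead k = a].
    apply: contrapT => no_k; apply: nsa; split=> // k Kk k0.
    by apply/eqP => ka; apply: no_k; exists k.
  pose q := 'X_[a] - (mleadc k)^-1 *: k.
  have c0 : mleadc k != 0 by rewrite mleadc_eq0.
  have Kq : K ('X_[a] - q) by rewrite opprB addrC subrK; apply: linear_setZ.
  have qu : polys_le u q.
    apply: linear_setB => //; first exact/polys_le_X.
    by apply: linear_setZ => //; exact: Kk.1.
  have qlt b : q@_b != 0 -> (b < a)%O.
    rewrite mcoeffB mcoeffX mcoeffZ; have [<-|ab] := eqVneq a b.
      by rewrite -ka mulVf // subrr eqxx.
    rewrite sub0r oppr_eq0 mulf_eq0 negb_or => /andP[_].
    rewrite -mcoeff_msupp => /msupp_le_mlead.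
    by rewrite ka le_eqVlt eq_sym (negbTE ab).
  have : [set p | exists2 a, lin_span B a & K (p - a)] q.
    rewrite [q]mpolyE; rewrite /= big_seq; elim/big_rec: _ => [|b v bq [w Bw Kw]].
      by exists 0; rewrite ?subrr; [exact: lB.1|exact: lK.1].
    have ba : (b < a)%O by apply: qlt; rewrite -mcoeff_msupp.
    have [w' Bw' Kw'] := IH b ba (leq_trans (lemc_mdeg (ltW ba)) au).
    exists (q@_b *: w' + w); first exact: lB.2.
    by rewrite opprD addrACA -scalerBr; apply: lK.2.
  move=> [w Bw Kw]; exists w => //.
  by rewrite -[_ - w](subrKA q); apply: linear_setD.
Qed.

Section BorderIdeal.
Variable B : set {mpoly R[n]}.
Hypothesis admB : admissible_basis u G B.

Local Notation phi := (proj_along (lin_span B) K).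
Local Notation border := [set p - phi p | p in boundary B].
Let dsB : direct_sum (polys_le u) (lin_span B) K. Proof. by case: admB. Qed.
Let lB : linear_set (lin_span B) := @lin_span_linear _ _ B.

Let B_le p : lin_span B p -> polys_le u.-1 p.
Proof.
apply: lin_span_min; first exact: polys_le_linear.
by case: admB => Bu _ _ q /Bu[a ha <-]; apply/polys_le_X.
Qed.

Let BX_le i p : polys_le u.-1 p -> polys_le u ('X_i * p).
Proof.
by move=> pu; rewrite -[u]prednK // -add1n; apply: polys_leM => //; apply: polys_le_X1.
Qed.

Lemma border_le p : boundary B p -> polys_le u p.
Proof.
move=> [[/sub_lin_span/B_le pu|[i [q [/sub_lin_span/B_le qu ->]]]] _].
  exact: polys_leW (leq_pred u) pu.
exact: BX_le.
Qed.

Lemma border_ideal_sub (J : set {mpoly R[n]}) : ideal_set J ->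
  (forall p, K p -> J p) -> ideal_gen border `<=` J.
Proof.
move=> idJ KJ; apply: ideal_gen_min => // _ [p /border_le pu <-].
exact/KJ/(proj_alongP dsB pu).2.
Qed.

(** An empty [B] would put R[x]_u inside Span G; connectedness of a nonempty [B] yields the empty
    product 1. *)
Lemma admissible_basis1 : ~ (forall p, polys_le u p -> lin_span G p) -> B 1.
Proof.
move=> nK; have [p Bp] : exists p, B p.
  apply: contrapT => B0; apply: nK => p pu.
  have [q Bq [_ Gpq]] := direct_sumP dsB pu.
  suff q0 : q = 0 by rewrite q0 subr0 in Gpq.
  have : lin_span B `<=` [set 0].
    apply: lin_span_min => [|v Bv]; last by case: B0; exists v.
    by split=> // c v w -> ->; rewrite scaler0 addr0.
  exact.
have [_ cB _] := admB; have [w _ /(_ 0%N (leq0n _))] := cB p Bp.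
by rewrite take0 big_nil.
Qed.

(* By induction on the degree, every monomial is congruent to an element of
   the span of B, modulo both the border ideal and the span of G. *)
Lemma sub_border_ideal p : B 1 -> K p -> ideal_gen border p.
Proof.
move=> B1; set J := ideal_gen border.
have idJ : ideal_set J := ideal_gen_ideal _; have lJ := ideal_linear idJ.
pose T := J `&` lin_span G; have lT : linear_set T := linear_setI lJ lG.
have shift i q : lin_span B q -> exists2 a, lin_span B a & T ('X_i * q - a).
  apply: (@lin_span_min _ _ B
    [set q | exists2 a, lin_span B a & T ('X_i * q - a)]) => [|b Bb].
    split=> [|c v w [a Ba Ta] [b Bb Tb]].
      by exists 0; rewrite ?mulr0 ?subrr; [exact: lB.1|exact: lT.1].
    exists (c *: a + b); first exact: lB.2.
    by rewrite mulrDr -scalerAr opprD addrACA -scalerBr; apply: lT.2.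
  have [BXb|nBXb] := EM (B ('X_i * b)).
    exists ('X_i * b); first exact: sub_lin_span.
    by rewrite subrr; exact: lT.1.
  have bXb : boundary B ('X_i * b) by split=> //; right; exists i, b.
  have [Ba [_ Ga]] := proj_alongP dsB (border_le bXb).
  by exists (phi ('X_i * b)) => //; split=> //; apply: sub_ideal_gen; exists ('X_i * b).
have red q : polys_le u q -> exists2 a, lin_span B a & T (q - a).
  move=> qu; apply: (@linear_set_poly n R
    [set q | exists2 a, lin_span B a & T (q - a)] u) => //.
    split=> [|c v w [a Ba Ta] [b Bb Tb]].
      by exists 0; rewrite ?subrr; [exact: lB.1|exact: lT.1].
    exists (c *: a + b); first exact: lB.2.
    by rewrite opprD addrACA -scalerBr; apply: lT.2.
  elim/mnm_ind => [_|i a IH].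
    exists 1; first exact: sub_lin_span.
    by rewrite mpolyX0 subrr; exact: lT.1.
  rewrite mdegD mdeg1 add1n => au.
  have [b Bb [Jb Gb]] := IH (ltnW au); have [c Bc Tc] := shift i b Bb.
  exists c => //; rewrite mpolyXD.
  apply: (linear_set_trans lT (v := 'X_i * b)) => //; rewrite -mulrBr; split.
    by case: idJ => _ _; apply.
  (* Both ['X_[a]] and [b] have degree at most [u.-1], so multiplication by ['X_i] stays within the
     range of [spanX]. *)
  apply: spanX => //; apply/BX_le; apply: linear_setB (B_le Bb).
    exact: polys_le_linear.
  by apply/polys_le_X; rewrite -ltnS prednK.
move=> [pu Gp]; have [a Ba [Ja Ga]] := red p pu.
suff a0 : a = 0 by rewrite a0 subr0 in Ja.
case: dsB => _ capB; suff : (lin_span B `&` K) a by rewrite capB.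
split=> //; split; first exact: (polys_leW (leq_pred u) (B_le Ba)).
by rewrite -[a](subrK p) -opprB addrC; apply: linear_setB.
Qed.

End BorderIdeal.

End BorderBases.

(** * The rank condition and the conditions (A) and (B) *)

Section Truncation.
Variables (n m : nat) (R : realType) (h : 'I_m -> {mpoly R[n]}) (t s : nat).
Variable L : dual_le n R t.
Implicit Types (p q : {mpoly R[n]}).
Hypotheses (gL : generic h L) (hs : (s.+1 <= t./2)%N).

Local Notation r := t./2.
Local Notation I := (ideal_gen (range h)).
Local Notation l := (mfun L).
Local Notation G := (Gset h L).
Local Notation N := (radical s.+1 l).
Local Notation J := (ideal_gen N).
Local Notation D := (\max_(j < m) tdeg (h j))%N.

Let lG : linear_set (lin_span G) := @lin_span_linear _ _ G.
Let lS u : linear_set (@polys_le n R u) := polys_le_linear n R u.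
Let idJ : ideal_set J := ideal_gen_ideal N.
Let lJ : linear_set J := ideal_linear idJ.

(** In this section [s.+1] stands for the s of the theorem; [rank_flat] identifies this condition
    with (R). *)
Definition flat : Prop :=
  forall p, polys_le s.+1 p -> exists2 q, polys_le s q & N (p - q).

Let s2t : (s.+1.*2 <= t)%N.
Proof. by apply: leq_trans (half_le t); rewrite leq_double. Qed.

Let leS p : polys_le s p -> polys_le s.+1 p := polys_leW (leqnSn s).
Let le2 p : polys_le s.+1 p -> polys_le s.+1.*2 p.
Proof. by apply: polys_leW; rewrite -addnn leq_addl. Qed.

Let l_ge0 : nonneg s.+1 l.
Proof. exact: nonnegW hs (Kset_nonneg gL.1). Qed.

(** By positivity a kernel vector of M_(s+1)(L) is also one of the full moment matrix, hence in N_t,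
    and W_t contains its multiples. *)
Lemma radical_span p a : (mdeg a <= s.+1)%N -> N p -> lin_span G ('X_[a] * p).
Proof.
move=> ha pN; apply: span_mul_radical; first exact: leq_trans ha hs.
by apply/(radicalW hs (Kset_nonneg gL.1) pN.1).
Qed.

Lemma radical_sub_span p : N p -> lin_span G p.
Proof. by move=> pN; rewrite -[p]mul1r -mpolyX0; apply: radical_span; rewrite ?mdeg0. Qed.

(** [S] is abstract because it is taken to be Span G for (A), and Span G intersected with [J] for
    the converse. A monomial is split in two halves; the second absorbs the variables of the first
    one by one, and [flat] brings it back to degree [s] each time. *)
Lemma flat_reduction (S : set {mpoly R[n]}) : flat -> linear_set S ->
  (forall p a, (mdeg a <= s.+1)%N -> N p -> S ('X_[a] * p)) ->
  forall p, polys_le s.+1.*2 p -> exists2 q, polys_le s q & S (p - q).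
Proof.
move=> fl linS SN.
have lT : linear_set [set p | exists2 q, polys_le s q & S (p - q)].
  split=> [|a u v [p ps Sp] [q qs Sq]].
    by exists 0; [exact: (lS s).1 | rewrite subrr; exact: linS.1].
  exists (a *: p + q); first exact: (lS s).2.
  by rewrite opprD addrACA -scalerBr; apply: linS.2.
have key b : (mdeg b <= s.+1)%N -> forall p, polys_le s.+1 p ->
    exists2 q, polys_le s q & S ('X_[b] * p - q).
  elim/mnm_ind: b => [_|i b IH hb] p ps; have [q qs Npq] := fl p ps.
    exists q => //; have := SN _ 0%MM _ Npq.
    by rewrite mdeg0 !mpolyX0 !mul1r; apply.
  rewrite mdegD mdeg1 add1n in hb.
  have xq : polys_le s.+1 ('X_i * q).
    by rewrite -add1n; apply: polys_leM => //; apply: polys_le_X1.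
  have [q' q's Sq'] := IH (ltnW hb) _ xq; exists q' => //.
  apply: (linear_set_trans linS (v := 'X_[U_(i) + b] * q)).
    by rewrite -mulrBr; apply: SN => //; rewrite mdegD mdeg1 add1n.
  by rewrite mpolyXD -mulrA mulrCA.
move=> p ps; apply: (linear_set_poly lT ps) => k; rewrite -addnn.
move=> /mnm_split[a [b [-> ha hb]]] /=; rewrite mpolyXD.
by apply: key => //; apply/polys_le_X.
Qed.

Lemma rank_flat :
  \rank (moment_mx s.+1 L) = \rank (moment_mx s L) <-> flat.
Proof. exact: rank_moment_eq. Qed.

Definition span_reduces : Prop := forall p, polys_le s.+1.*2 p ->
  exists2 q, polys_le s q & lin_span G (p - q).

Definition span_plus_closed : Prop := forall p, polys_le s.+1.*2 p ->
  lin_span (plus G) p -> lin_span G p.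

Let s_le_2s : (s <= s.+1.*2)%N.
Proof. by rewrite doubleS -addnn !leqW // leq_addr. Qed.

Lemma dim_restr_perp_reduces :
  dim_restr_perp s.+1.*2 t G = dim_restr_perp s t G <-> span_reduces.
Proof.
have Gt := @Gset_le _ _ _ h _ L; rewrite !dim_restr_perpE //; last exact: leq_trans s2t.
by rewrite /span_reduces -(codim_eq s_le_2s lG); split=> ->.
Qed.

Lemma plus_le u (S : set {mpoly R[n]}) :
  S `<=` polys_le u -> plus S `<=` polys_le u.+1.
Proof.
move=> Su p [/Su|[i [q [/Su qu ->]]]]; first by apply: polys_leW.
by rewrite -add1n; apply: polys_leM => //; apply: polys_le_X1.
Qed.

Lemma dim_restr_perp_plus : dim_restr_perp s.+1.*2 t G =
  dim_restr_perp s.+1.*2 t.+1 (plus G) <-> span_plus_closed.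
Proof.
have Gt := @Gset_le _ _ _ h _ L; rewrite !dim_restr_perpE //; last 2 first.
- exact: leqW.
- exact: plus_le.
apply: codim_sub => //; first exact: lin_span_linear.
by apply: lin_span_sub => p; left.
Qed.

Lemma flat_reduces : flat -> span_reduces.
Proof.
move=> fl; apply: flat_reduction => // p a ha pN; exact: radical_span.
Qed.

(** All products of [h j] with monomials of degree at most [s.+1] have degree at most
    [s.+1.*2 <= t], so they are in H_t and [L] kills them. *)
Lemma generators_radical : (D <= s.+1)%N -> I `<=` J.
Proof.
move=> hD; apply: ideal_gen_min => // _ [j _ <-]; apply: sub_ideal_gen.
have hj : (tdeg (h j) <= s.+1)%N by apply: leq_trans hD; apply: leq_bigmax.
apply/radicalP; split=> [|a ha].
  by apply: (polys_leW hj); rewrite /polys_le /= /tdeg; case: (msize _).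
apply: (mfun_Hset gL.1); exists a, j; split; last by rewrite mulrC.
by apply: leq_trans s2t; rewrite -addnn leq_add.
Qed.

Lemma flat_plus_closed : flat -> (D <= s.+1)%N -> span_plus_closed.
Proof.
move=> fl hD p ps plusp.
have [l' [l'l l'0 l'J]] := flat_extension l_ge0 fl.
have IJ := generators_radical hD.
have HJ : Hset h t `<=` J by move=> q /Hset_ideal /IJ.
have Kl' : Kset h t (trunc t l').
  apply: KsetP => [q hq|q qr]; rewrite mfun_trunc //.
  - by apply: pos_vanish => //; apply/l'J/HJ.
  - exact: (@Hset_le _ _ _ h).
  - exact/(polys_leW (half_le t))/polys_le_sqr.
have GJ : G `<=` J.
  move=> q [/HJ //|/WsetE[a [g [ar gr ->]]]].
  case: idJ => _ _; apply; apply/l'J; rewrite -(mfun_trunc (t := t)).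
    by rewrite expr2; apply: (generic_radical gL Kl' gr).2; case: gr.
  by apply/(polys_leW (half_le t))/polys_le_sqr; case: gr.
have plusJ : plus G `<=` J.
  move=> q [/GJ //|[i [g [/GJ gJ ->]]]]; case: idJ => _ _; exact.
have pJ : J p by apply: (lin_span_min lJ plusJ).
(* Reducing by Span G alone leaves a remainder [q] in [J]; it suffices that [q] is in Span G. *)
have [q qs Gpq] := flat_reduces fl ps.
have qJ : J q.
  rewrite -[q](subrK p) addrC -[q - p]opprB; apply: (linear_setB lJ) => //.
  exact: (lin_span_min lJ GJ).
have /radical_sub_span qG : N q.
  apply/(radical_sqr l_ge0 (leS qs)); rewrite -l'l; first exact/l'J.
  exact/polys_le_sqr/leS.
by rewrite -[p](subrK q); apply: linear_setD.
Qed.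

Section Converse.
Hypotheses (condA : span_reduces) (condB : span_plus_closed).

Lemma span_mulX i p : lin_span G p -> polys_le s.+1.*2 ('X_i * p) ->
  lin_span G ('X_i * p).
Proof.
move=> Gp /condB; apply.
apply: (@lin_span_min _ _ G [set p | lin_span (plus G) ('X_i * p)]) Gp.
  have lP := @lin_span_linear _ _ (plus G).
  split=> [|a u v] /=; first by rewrite mulr0; exact: lP.1.
  by rewrite mulrDr -scalerAr; apply: lP.2.
by move=> q Gq; apply: sub_lin_span; right; exists i, q.
Qed.

(** By (B) the multiples ['X_[a] * p] stay in Span G up to degree [s.+1.*2], and [L] vanishes on
    Span G. *)
Lemma span_radical p : polys_le s.+1 p -> lin_span G p -> N p.
Proof.
move=> ps Gp; apply/radicalP; split=> // a ha; rewrite mulrC.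
apply: (mfun_span gL.1); apply: (@spanXm _ _ s.+1.*2 G span_mulX _ _ _ Gp ps).
by rewrite -addnn leq_add2r.
Qed.

Lemma converse_flat : flat.
Proof.
move=> p ps; have [q qs Gpq] := condA (le2 ps); exists q => //.
by apply: span_radical Gpq; apply: (linear_setB (lS _) ps); apply: leS.
Qed.

(** Reducing [p] modulo Span G and [J] at once leaves a remainder of degree at most [s] in Span G,
    hence in the kernel. *)
Lemma span_sub_ideal p : polys_le s.+1.*2 p -> lin_span G p -> J p.
Proof.
move=> ps Gp.
have [||q qs [Gpq Jpq]] := flat_reduction converse_flat (S := lin_span G `&` J) _ _ ps.
- exact: linear_setI.
- move=> k a ha kN; split; first exact: radical_span.
  by case: idJ => _ _; apply; apply: sub_ideal_gen.
rewrite -[p](subrK q); apply: linear_setD => //; apply: sub_ideal_gen.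
apply: span_radical; first exact: leS.
by rewrite -[q](subrK p) -opprB addrC; apply: linear_setB.
Qed.

Lemma J_real_radical : is_real_radical J.
Proof.
have [l' [_ l'0 l'J]] := flat_extension l_ge0 converse_flat.
exact: is_real_radical_pos l'0 l'J.
Qed.

Lemma J_sub_real_radical : J `<=` real_radical I.
Proof.
apply: ideal_gen_min; first exact/real_radical_ideal/ideal_gen_ideal.
move=> p pN; apply: (generic_real_radical gL).
exact/(radicalW hs (Kset_nonneg gL.1) pN.1).
Qed.

Lemma J_eq_real_radical : (D <= s.+1)%N -> J = real_radical I.
Proof.
move=> hD; apply/seteqP; split; first exact: J_sub_real_radical.
by rewrite J_real_radical; apply/real_radicalS/generators_radical.
Qed.

End Converse.

End Truncation.

(** * Column bases *)

Section ColumnBasis.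
Variables (n : nat) (R : realType) (u t : nat) (L : dual_le n R t).
Local Notation A := (moment_mx u L).
Local Notation N := #|{: 'X_{1..n < u.+1}}|.

(** The columns are the images of the monomials under [f], multiplication of coefficient vectors by
    [A], whose kernel is Ker M_u. The images of a free family form a basis of [limg f] exactly when
    its span is a complement of that kernel. *)
Lemma column_basisE (B : set {mpoly R[n]}) : B `<=` monoms_le u ->
  direct_sum (polys_le u) (lin_span B) (ker_moment u L) <->
  indexes_column_basis u L B.
Proof.
move=> Bu; pose c (x : mpoly_le n R u) : 'cV[R]_N := A *m \col_i (val x)@_(bmon i).
have c_lin : linear c.
  move=> a x y; rewrite /c scalemxAr -mulmxDr; congr (_ *m _).
  by apply/colP => i; rewrite !mxE !linearP.
pose cL : {linear mpoly_le n R u -> 'cV[R]_N} :=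
  HB.pack c (GRing.isLinear.Build _ _ _ _ _ c_lin).
pose f := linfun cL.
have fE x : f x = A *m \col_i (val x)@_(bmon i) by rewrite lfunE.
have kerE x : x \in lker f <-> ker_moment u L (val x).
  rewrite memv_ker fE; split=> [/eqP E|[_ /= ->]] //.
  by split=> //; apply: polys_le_mpoly_le.
pose mon (i : 'I_N) : mpoly_le n R u := insubd 0 'X_[bmon i].
have val_mon i : val (mon i) = 'X_[bmon i].
  by rewrite val_insubd //; apply/polys_le_X/bmon_le.
have f_mon i : f (mon i) = col i A.
  rewrite fE colE; congr (_ *m _); apply/colP => j.
  by rewrite !mxE val_mon mcoeffX (inj_eq (@bmon_inj n u)) eqxx andbT eq_sym.
pose X := [seq mon i | i <- enum 'I_N & `[< B 'X_[bmon i] >]].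
have span_mon : <<[seq mon i | i <- enum 'I_N]>>%VS = fullv.
  apply/vspaceP => x; rewrite memvf.
  have -> : x = \sum_i (val x)@_(bmon i) *: mon i.
    apply: val_inj; rewrite linear_sum -{1}(row_polyK (polys_le_mpoly_le x)).
    by apply: eq_bigr => i _; rewrite linearZ /= mxE -val_mon.
  apply: memv_suml => i _; apply/memvZ/memv_span/map_f; exact: mem_enum.
have freeX : free X.
  have : free [seq mon i | i <- enum 'I_N].
    by rewrite /free span_mon dimvf size_map size_enum_ord.
  (* The selected monomials are the head of a permutation of the full monomial basis. *)
  have /(perm_map mon)/perm_free <- := permEl (perm_filterC
    (fun i => `[< B 'X_[bmon i] >]) (enum 'I_N)).
  by rewrite map_cat => /catl_free.
have mapE (P : pred 'I_N) : [seq col i A | i <- enum 'I_N & P i] =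
    [seq f x | x <- [seq mon i | i <- enum 'I_N & P i]].
  by elim: [seq i <- enum 'I_N | P i] => //= i e ->; rewrite f_mon.
have colsE : <<[seq col i A | i <- enum 'I_N]>>%VS = limg f.
  rewrite -span_mon limg_span; congr <<_>>%VS.
  by elim: (enum 'I_N) => //= i e ->; rewrite f_mon.
rewrite /indexes_column_basis colsE mapE -/X.
have lB := @lin_span_linear _ _ B.
have memX x : x \in <<X>>%VS <-> lin_span B (val x).
  split=> [xX|Bx].
    apply/(vleP x lB); move: xX; apply/subvP/span_subvP => y.
    move=> /mapP[i]; rewrite mem_filter => /andP[/asboolP Bi _] ->.
    by apply/vleP => //; rewrite val_mon; apply: sub_lin_span.
  have lX : linear_set
      [set p | polys_le u p /\ insubd (0 : mpoly_le n R u) p \in <<X>>%VS].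
    have lu := polys_le_linear n R u.
    split=> [|a p q [pu pX] [qu qX]].
      split; first exact: lu.1.
      rewrite (_ : insubd _ _ = 0) ?mem0v //; apply: val_inj.
      by rewrite val_insubd //; exact: lu.1.
    split; first exact: lu.2.
    rewrite (_ : insubd _ _ = a *: insubd 0 p + insubd 0 q).
      by rewrite memvD ?memvZ.
    apply: val_inj; rewrite -[RHS]/(a *: val (insubd _ p) + val (insubd _ q)).
    by rewrite !val_insubd //; exact: lu.2.
  have [|_] := lin_span_min lX _ Bx.
    move=> p Bp; have [a au pE] := Bu _ Bp; have [i iE] := bmon_surj au.
    rewrite -pE -iE; split; first exact/polys_le_X/bmon_le.
    apply/memv_span/map_f; rewrite mem_filter mem_enum andbT.
    by apply/asboolP; rewrite iE pE.
  rewrite (_ : insubd _ _ = x) //; apply: val_inj.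
  by rewrite val_insubd //; apply: polys_le_mpoly_le.
have lu := polys_le_linear n R u.
have B_le p : lin_span B p -> polys_le u p.
  by apply: lin_span_min => // q /Bu[a au <-]; apply/polys_le_X.
have ker_le p : ker_moment u L p -> polys_le u p by case.
have k0 : ker_moment u L 0.
  by have := (kerE 0).1 (mem0v _); rewrite linear0.
have -> : direct_sum (polys_le u) (lin_span B) (ker_moment u L) <->
    (<<X>> :&: lker f = 0)%VS /\ (<<X>> + lker f = fullv)%VS.
  split=> [[sumB capB]|[capX sumX]].
    split; last first.
      apply/vspaceP => x; rewrite memvf.
      have := polys_le_mpoly_le x; rewrite sumB => -[a Ba [b kb abx]].
      have [au bu] := (B_le _ Ba, ker_le _ kb).
      have -> : x = insubd 0 a + insubd 0 b.
        apply: val_inj; rewrite -[RHS]/(val (insubd _ a) + val (insubd _ b)).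
        by rewrite !val_insubd.
      by apply: memv_add; [apply/memX|apply/kerE]; rewrite val_insubd.
    apply/eqP; rewrite -subv0; apply/subvP => x /memv_capP[/memX Bx /kerE kx].
    rewrite memv0; apply/eqP/val_inj; rewrite linear0.
    by suff : [set 0] (val x) by []; rewrite -capB.
  split; apply/seteqP; split=> p.
  - move=> pu; have : insubd (0 : mpoly_le n R u) p \in (<<X>> + lker f)%VS.
      by rewrite sumX memvf.
    move=> /memv_addP[x /memX Bx [y /kerE ky /(congr1 val)]].
    by rewrite val_insubd // => ->; exists (val x) => //; exists (val y).
  - by move=> [a /B_le au [b /ker_le bu <-]]; apply: linear_setD.
  - move=> [Bp kp]; have pu := B_le _ Bp.
    have : insubd (0 : mpoly_le n R u) p \in (<<X>> :&: lker f)%VS.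
      by apply/memv_capP; split; [apply/memX|apply/kerE]; rewrite val_insubd.
    by rewrite capX memv0 => /eqP/(congr1 val); rewrite val_insubd // linear0.
  - by move=> ->; split=> //; exact: lB.1.
split=> [[capX sumX]|bas].
  have fk0 : (f @: lker f = 0)%VS by apply/eqP; rewrite -lkerE subvv.
  rewrite -sumX limgD fk0 addv0; apply: limg_basis_of capX _.
  by rewrite /basis_of eqxx.
have imgX : (f @: <<X>> = limg f)%VS by rewrite limg_span (span_basis bas).
split.
  (* [X] and its image under [f] are free of the same size, so [f] loses no dimension on the span of
     [X]. *)
  apply/eqP; rewrite -dimv_eq0; have := limg_ker_dim f <<X>>%VS.
  rewrite limg_span (eqP (basis_free bas)) (eqP freeX) size_map.
  by rewrite -[RHS]add0n => /addIn ->.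
apply/vspaceP => x; rewrite memvf.
have : f x \in (f @: <<X>>)%VS by rewrite imgX memv_img ?memvf.
move=> /memv_imgP[y yX fxy]; rewrite -[x](subrK y) addrC; apply: memv_add => //.
by rewrite memv_ker linearB /= fxy subrr.
Qed.

End ColumnBasis.

Theorem proposition12 (R : realType) (n m : nat) (h : 'I_m -> {mpoly R[n]})
    (t s : nat) (L : dual_le n R t)
    (hL : generic h L) (hs : (1 <= s <= t./2)%N) :
  let I := ideal_gen (range h) in
  let D := (\max_(j < m) tdeg (h j))%N in
  let G := Gset h L in
  let rank_cond := \rank (moment_mx s L) = \rank (moment_mx s.-1 L) in
  let cond_A :=
    dim_restr_perp s.*2 t G = dim_restr_perp s.-1 t G in
  let cond_B :=
    dim_restr_perp s.*2 t G = dim_restr_perp s.*2 t.+1 (plus G) in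
  (rank_cond -> cond_A /\ ((D <= s)%N -> cond_B)) /\
  (cond_A -> cond_B ->
    [/\ rank_cond,
        exists B0, admissible_basis s.*2 G B0,
        forall B0, admissible_basis s.*2 G B0 ->
          let J := border_ideal s.*2 t G B0 in
          [/\ is_real_radical J,
              J = ideal_gen (ker_moment s L),
              J `<=` vanishing_ideal (real_variety I) &
              (D <= s)%N -> J = real_radical I] &
        forall B : set {mpoly R[n]}, B `<=` monoms_le s.-1 ->
          direct_sum (polys_le s.-1) (lin_span B) (lin_span G `&` polys_le s.-1)
          <-> indexes_column_basis s.-1 L B]).
Proof.
case: s hs => // s /andP[_ hs] /=.
set I := ideal_gen (range h); set G := Gset h L.
have s2t : (s.+1.*2 <= t)%N by apply: leq_trans (half_le t); rewrite leq_double.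
split=> [/(rank_flat L hs) fl|].
  split=> [|hD]; first exact/dim_restr_perp_reduces/flat_reduces.
  exact/dim_restr_perp_plus/flat_plus_closed.
move=> /(dim_restr_perp_reduces h L hs) A' /(dim_restr_perp_plus h L hs) B'.
have spanX := span_mulX B'.
have fl := converse_flat hL A' B'.
have lG : linear_set (lin_span G) := @lin_span_linear _ _ G.
pose N := radical s.+1 (mfun L); pose J := ideal_gen N.
have kerE : ker_moment s.+1 L = N by apply: ker_momentE.
split.
- exact/(rank_flat L hs).
- apply: (exists_admissible_basis _ spanX (s := s)) => //.
  by rewrite doubleS !ltnS -addnn leqW // leq_addr.
- move=> B0 admB.
  have J0E : border_ideal s.+1.*2 t G B0 = J.
    rewrite /border_ideal dim_restr_perpE //; last exact: Gset_le.
    case: eqP => [/(codim_eq0 _ lG) all_span|/(codim_eq0 _ lG) nall].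
      (* Degenerate case: every polynomial of degree at most [s.+1.*2], in particular 1, is in Span
         G, so 1 is in [J]. *)
      apply/seteqP; split=> // p _; rewrite -[p]mulr1.
      case: (ideal_gen_ideal N) => _ _; apply.
      have one_le := polys_le1 n R s.+1.*2.
      exact: (span_sub_ideal hL hs A' B' one_le (all_span _ one_le)).
    have idJ := ideal_gen_ideal N.
    apply/seteqP; split.
      apply: border_ideal_sub => // p [pu Gp]; exact: (span_sub_ideal hL hs A' B').
    apply: ideal_gen_min; first exact: ideal_gen_ideal.
    move=> p pN; apply: sub_border_ideal => //.
      exact: admissible_basis1 nall.
    split; last exact: radical_sub_span pN.
    by apply: (polys_leW _ pN.1); rewrite -addnn leq_addl.
  rewrite J0E kerE; split=> //.
  + exact: (J_real_radical hL hs A' B').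
  + move=> p /(J_sub_real_radical hL hs)/real_radical_vanishing; exact.
  + exact: (J_eq_real_radical hL hs A' B').
- move=> B Bs; have ss : (s.*2 <= t)%N by apply: leq_trans s2t; rewrite leq_double.
  (* In degree at most [s], Span G agrees with the kernel for [s.+1] by (B), and positivity
     identifies the latter with the kernel for [s]. *)
  rewrite -column_basisE //; suff -> : lin_span G `&` polys_le s = ker_moment s L by [].
  have l0 : nonneg s.+1 (mfun L) := nonnegW hs (Kset_nonneg hL.1).
  rewrite (ker_momentE _ ss); apply/seteqP; split=> p.
    move=> [Gp ps]; apply/(radicalW (leqnSn s) l0 ps).
    by apply: (span_radical hL B') => //; apply: polys_leW ps.
  move=> pN; split; last exact: pN.1.
  by apply/(radical_sub_span hL hs)/(radicalW (leqnSn s) l0 pN.1).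
Qed.
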